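(* Let $(R,\mathfrak m,k)$ be a complete local integral domain of dimension $d$, and let $\mathcal Q(R)$ be its fraction field, regarded as an $R$-module. The following assertions are valid: (a) Suppose $d=1$. Then $\operatorname{pd}_R(\mathcal Q(R))=1$. (b) If $d=2$ and $R$ is a unique factorization domain, then $\operatorname{pd}_R(\mathcal Q(R))=2$. (c) Assume the continuum hypothesis $2^{\aleph_0}=\aleph_1$ and that the residue field is $k=\mathbb C$. Then $\operatorname{pd}_R(\mathcal Q(R))\le 2$. (d) Assume the continuum hypothesis $2^{\aleph_0}=\aleph_1$, that $k=\mathbb C$, and that $R$ is a unique factorization domain of dimension bigger than one. Then $\operatorname{pd}_R(\mathcal Q(R))=2$.
   Context: Rings are commutative and noetherian; complete means complete in the $\mathfrak m$-adic topology. $\operatorname{pd}_R$ denotes projective dimension over $R$. *)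

(* Defs.v *)
From HB Require Import structures.
From mathcomp Require Import all_boot all_order all_algebra.
From mathcomp Require Import ring_quotient fraction complex.
From mathcomp Require Import boolp classical_sets cardinality reals.

Set Implicit Arguments.
Unset Strict Implicit.
Unset Printing Implicit Defensive.

Import GRing.Theory.
Local Open Scope classical_set_scope.
Local Open Scope ring_scope.

(* Ideals are Prop-valued sets: the library's [idealr] is boolean-valued and   *)
(* always proper.                                                              *)
Section Ideals.
Variable R : comNzRingType.
Implicit Types (I J m : set R).

Definition is_ideal I : Prop :=
  [/\ I 0, forall x y, I x -> I y -> I (x + y) & forall a x, I x -> I (a * x)].

Definition is_proper_ideal I : Prop := is_ideal I /\ I != setT.

Definition is_prime_ideal I : Prop :=
  is_proper_ideal I /\ forall x y, I (x * y) -> I x \/ I y.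

Definition is_maximal_ideal I : Prop :=
  is_proper_ideal I /\ forall J, is_proper_ideal J -> I `<=` J -> J = I.

Definition ideal_span (A : set R) : set R :=
  [set x | exists s : seq (R * R),
     (forall p, p \in s -> A p.2) /\ x = \sum_(p <- s) p.1 * p.2].

Definition ideal_pow I (n : nat) : set R :=
  ideal_span [set x | exists f : 'I_n -> R,
                (forall i, I (f i)) /\ x = \prod_(i < n) f i].

Definition noetherian : Prop :=
  forall I, is_ideal I -> exists s : seq R, I = ideal_span [set` s].

Definition is_local m : Prop :=
  is_maximal_ideal m /\ forall J, is_maximal_ideal J -> J = m.

Definition prime_chain (n : nat) : Prop :=
  exists p : nat -> set R,
    (forall i, (i <= n)%N -> is_prime_ideal (p i)) /\
    (forall i, (i < n)%N -> p i `<` p i.+1).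

Definition krull_dim (d : nat) : Prop :=
  prime_chain d /\ forall n, prime_chain n -> (n <= d)%N.

Definition adic_cauchy I (u : nat -> R) : Prop :=
  forall n, exists N, forall i j, (N <= i)%N -> (N <= j)%N ->
    ideal_pow I n (u i - u j).

Definition adic_cvg I (u : nat -> R) (l : R) : Prop :=
  forall n, exists N, forall i, (N <= i)%N -> ideal_pow I n (u i - l).

(* Completeness includes separatedness, i.e. uniqueness of limits. *)
Definition adic_complete I : Prop :=
  forall u, adic_cauchy I u -> exists! l, adic_cvg I u l.

Definition local_ideal m of is_local m : pred R := fun x => `[< m x >].

Fact local_idealP m (hm : is_local m) : idealr_closed (local_ideal hm).
Proof.
have inP x : x \in local_ideal hm <-> m x.
  by rewrite unfold_in; split => /asboolP.
have [[[[m0 mD mM] m_proper] _] _] := hm; split; first exact/inP.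
  apply/negP => /inP m1; move/eqP: m_proper; apply.
  by apply/seteqP; split => // x _; rewrite -[x]mulr1; exact: mM.
by move=> a x xm y ym; apply/inP/mD; [apply/mM/inP | exact/inP].
Qed.

Definition local_idealr m (hm : is_local m) : idealr R :=
  HB.pack_for (idealr R) (local_ideal hm)
    (isIdealr.Build R (local_ideal hm) (local_idealP hm)).

Definition residue_ring m (hm : is_local m) : comNzRingType :=
  {ideal_quot (local_idealr hm)}.

Definition residue_field_iso m (hm : is_local m) (k : fieldType) : Prop :=
  exists f : {rmorphism residue_ring hm -> k}, bijective f.

End Ideals.

Section Factorization.
Variable R : idomainType.

Definition irreducible_elt (p : R) : Prop :=
  [/\ p != 0, p \isn't a GRing.unit &
      forall a b, p = a * b -> a \is a GRing.unit \/ b \is a GRing.unit].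

Definition associated (a b : R) : Prop :=
  exists2 u, u \is a GRing.unit & a = u * b.

Definition is_UFD : Prop :=
  (forall x : R, x != 0 -> x \isn't a GRing.unit ->
     exists s : seq R,
       (forall p, p \in s -> irreducible_elt p) /\ x = \prod_(p <- s) p) /\
  (forall s t : seq R,
     (forall p, p \in s -> irreducible_elt p) ->
     (forall p, p \in t -> irreducible_elt p) ->
     \prod_(p <- s) p = \prod_(p <- t) p ->
     exists t' : seq R, [/\ perm_eq t t', size s = size t' &
       forall i, (i < size s)%N -> associated s`_i t'`_i]).

End Factorization.

Section Homological.
Variable R : nzRingType.

Definition is_projective (P : lmodType R) : Prop :=
  forall (M N : lmodType R) (g : {linear M -> N}) (f : {linear P -> N}),
    (forall y, exists x, g x = y) ->
    exists h : {linear P -> M}, forall x, g (h x) = f x.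

(* M has a projective resolution 0 -> P_n -> ... -> P_0 -> M -> 0. *)
Definition pd_le (M : lmodType R) (n : nat) : Prop :=
  exists (P : nat -> lmodType R)
         (e : {linear P 0 -> M}) (d : forall i, {linear P i.+1 -> P i}),
    [/\ forall i, is_projective (P i),
        forall i, (n < i)%N -> forall x : P i, x = 0,
        forall y, exists x, e x = y,
        forall x, e x = 0 <-> exists y, d 0 y = x &
        forall i x, d i x = 0 <-> exists y, d i.+1 y = x].

(* For nonzero M; the zero module, of dimension -oo, would also get 0. *)
Definition pd_eq (M : lmodType R) (n : nat) : Prop :=
  pd_le M n /\ forall m, pd_le M m -> (n <= m)%N.

End Homological.

Section FractionModule.
Variable R : idomainType.

Definition fraction_module : Type := {fraction R}.

HB.instance Definition _ := GRing.Zmodule.on fraction_module.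

Definition fraction_scale (a : R) (x : fraction_module) : fraction_module :=
  (tofrac a : {fraction R}) * x.

Fact fraction_scaleA a b x :
  fraction_scale a (fraction_scale b x) = fraction_scale (a * b) x.
Proof. by rewrite /fraction_scale tofracM mulrA. Qed.

Fact fraction_scale1 : left_id 1 fraction_scale.
Proof. by move=> x; rewrite /fraction_scale tofrac1 mul1r. Qed.

Fact fraction_scaleDr : right_distributive fraction_scale +%R.
Proof. by move=> a x y; exact: mulrDr. Qed.

Fact fraction_scaleDl x : {morph fraction_scale^~ x : a b / a + b}.
Proof. by move=> a b; rewrite /fraction_scale tofracD; exact: mulrDl. Qed.

HB.instance Definition _ := GRing.Zmodule_isLmodule.Build R fraction_module
  fraction_scaleA fraction_scale1 fraction_scaleDr fraction_scaleDl.

End FractionModule.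

Local Open Scope card_scope.

(* The cardinal of A is the least uncountable one. *)
Definition has_card_aleph1 T (A : set T) : Prop :=
  ~ countable A /\ forall U (B : set U), ~ countable B -> A #<= B.

(* 2 ^ aleph_0 = aleph_1 *)
Definition continuum_hypothesis : Prop := has_card_aleph1 [set: set nat].

(* Main.v *)
(* Upper bounds come from resolutions of unions of chains R/t_0 <= R/t_1 <=  *)
(* ... inside Q = Frac R: such a union is the cokernel of an injection of    *)
(* {poly R} into itself, hence has projective dimension at most one.         *)
(* - In dimension one, Q = R[1/x] for any nonzero x in m.                    *)
(* - In the factorial dimension-two case, R[1/x] is a principal ideal        *)
(*   domain; partial fractions give an exact sequence 0 -> R[1/x]^(X) ->     *)
(*   R[1/x] + \bigoplus_(p in X) R[1/(xp)] -> Q -> 0, where X is a set of    *)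
(*   representatives of the primes, and a mapping cone resolves Q.           *)
(* - If k = C, a complete R has at most 2^aleph_0 = aleph_1 elements, so Q   *)
(*   is the union of a well-ordered chain of countable localizations, each   *)
(*   of projective dimension at most one; by Auslander's filtration argument *)
(*   the second syzygy of Q is projective.                                   *)
(* For the lower bounds, Kaplansky's argument shows that pd Q <= 1 forces Q  *)
(* to be countably generated. If R is factorial, it then has only countably  *)
(* many primes up to associates, and these cannot cover m when R is complete *)
(* of dimension at least two, by Baire's theorem.                            *)
Require Import Defs.
From HB Require Import structures.
From mathcomp Require Import all_boot all_order all_algebra finmap.
From mathcomp Require Import ring_quotient fraction complex.
From mathcomp Require Import boolp classical_sets functions cardinality fsbigop.
From mathcomp Require Import reals wochoice ring generic_quotient.

Set Implicit Arguments.
Unset Strict Implicit.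
Unset Printing Implicit Defensive.

Import Order.TTheory GRing.Theory Num.Theory.
Local Open Scope classical_set_scope.
Local Open Scope ring_scope.

(** * Submodules and relative lifting *)

(** The building block is the telescope: if [t n.+1 = s n * t n] with all [t n] nonzero, the union
    of the modules [R 1/t_n] in Q has a resolution with two copies of [{poly R}] ([tele_exact]). In
    dimension one Q itself is such a union ([dim1_power]). In the factorial dimension-two case,
    inverting [x] leaves dimension one, so fractions split into parts with a single prime in the
    denominator, and gluing the telescopes of these parts costs one more step ([factorial_dim2_pd]).
    Under the continuum hypothesis, an element of R is determined by countably many digits over C
    ([complete_local_inj]), so R has a well-order with countable initial segments
    ([ex_aleph1_order]). The localizations at these segments are telescopes, their second syzygies
    are direct summands of free modules, and [lifts_on_filtration] assembles the second syzygy of Q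
    from them.

    For the lower bounds, a projective Q would put infinitely divisible elements into a free module
    ([fraction_pd_gt0]). A resolution of length one has a countable part that already generates Q,
    so countably many denominators suffice ([fraction_pd1_countable]). For factorial R this bounds
    the primes up to associates by a countable set, whereas a successive approximation produces an
    element of [m] outside any countable family of principal primes ([ex_avoiding_irreducibles]). *)

Section Submodules.
Variable R : nzRingType.
Implicit Types V W M N : lmodType R.

Definition submodule V (S : set V) : Prop :=
  S 0 /\ forall a x y, S x -> S y -> S (a *: x + y).

Definition linear_on V W (S : set V) (f : V -> W) : Prop :=
  forall a x y, S x -> S y -> f (a *: x + y) = a *: f x + f y.

Definition mklinear V W (f : V -> W) (hf : linear f) : {linear V -> W} :=
  HB.pack f (GRing.isLinear.Build R V W *:%R f hf).

Lemma linear_linear_on V W (S : set V) (f : {linear V -> W}) : linear_on S f.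
Proof. by move=> a x y _ _; rewrite linearP. Qed.

Section SubmoduleTheory.
Variables (V : lmodType R) (S : set V) (hS : submodule S).

Lemma submodule0 : S 0. Proof. by case: hS. Qed.

Lemma submoduleD x y : S x -> S y -> S (x + y).
Proof. by move=> Sx Sy; rewrite -[x]scale1r; apply: hS.2. Qed.

Lemma submoduleZ a x : S x -> S (a *: x).
Proof. by move=> Sx; rewrite -[_ *: _]addr0; apply: hS.2 => //; case: hS. Qed.

Lemma submoduleB x y : S x -> S y -> S (x - y).
Proof. by move=> Sx Sy; rewrite addrC -scaleN1r; apply: hS.2. Qed.

Lemma submodule_sum (I : Type) (r : seq I) (P : pred I) (F : I -> V) :
  (forall i, P i -> S (F i)) -> S (\sum_(i <- r | P i) F i).
Proof. by move=> SF; apply: big_ind => //; [exact: submodule0|exact: submoduleD]. Qed.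

Lemma linear_on0 W (f : V -> W) : linear_on S f -> f 0 = 0.
Proof.
move=> /(_ 1 0 0 submodule0 submodule0).
by rewrite !scale1r addr0 -[X in X = _]addr0 => /addrI.
Qed.

Lemma linear_onD W (f : V -> W) x y :
  linear_on S f -> S x -> S y -> f (x + y) = f x + f y.
Proof. by move=> fl Sx Sy; rewrite -[x]scale1r fl// !scale1r. Qed.

Definition in_submodule of submodule S : {pred V} := fun x => `[< S x >].

Fact in_submodule_closed : GRing.submod_closed (in_submodule hS).
Proof.
split=> [|a x y /asboolP Sx /asboolP Sy]; apply/asboolP; first by case: hS.
exact: hS.2.
Qed.

HB.instance Definition _ :=
  GRing.isSubmodClosed.Build R V (in_submodule hS) in_submodule_closed.

Record submod : Type :=
  Submod { submod_val : V; submod_valP : submod_val \in in_submodule hS }.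

HB.instance Definition _ := [isSub for submod_val].
HB.instance Definition _ := [Choice of submod by <:].
HB.instance Definition _ := [SubChoice_isSubLmodule of submod by <:].

Lemma submodP (x : submod) : S (submod_val x).
Proof. by have /asboolP := submod_valP x. Qed.

Definition mksubmod x (Sx : S x) : submod := @Submod x (introT (asboolP _) Sx).

Lemma submod_inj (x y : submod) : submod_val x = submod_val y -> x = y.
Proof. exact: val_inj. Qed.

Lemma submod_val_linear : linear submod_val. Proof. by []. Qed.

HB.instance Definition _ :=
  GRing.isLinear.Build R submod V *:%R submod_val submod_val_linear.

End SubmoduleTheory.

Lemma submodule_setT V : submodule (@setT V). Proof. by []. Qed.

Lemma submodule_image V W (f : {linear V -> W}) (S : set V) :
  submodule S -> submodule (f @` S).
Proof.
move=> hS; split; first by exists 0; [exact: submodule0|exact: linear0].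
move=> a _ _ [x Sx <-] [y Sy <-]; exists (a *: x + y); last exact: linearP.
exact: hS.2.
Qed.

Lemma submodule_preimage V W (f : {linear V -> W}) (S : set W) :
  submodule S -> submodule (f @^-1` S).
Proof.
move=> hS; split=> [|a x y Sx Sy]; first by rewrite /preimage/= linear0; exact: hS.1.
by rewrite /preimage/= linearP; exact: hS.2.
Qed.

Lemma submodule_ker V W (f : {linear V -> W}) : submodule [set x | f x = 0].
Proof.
split=> /=; first exact: linear0.
by move=> a x y fx fy; rewrite linearP fx fy scaler0 addr0.
Qed.

(* Projectivity of the submodule [S] of [V], relative to a submodule [W] of   *)
(* the covering module, so that no subtype is needed to state it.            *)
Definition lifts_on V (S : set V) : Prop :=
  forall M N (g : {linear M -> N}) (W : set M) (f : V -> N),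
    submodule W -> linear_on S f ->
    (forall x, S x -> exists2 y, W y & g y = f x) ->
    exists h : V -> M,
      linear_on S h /\ forall x, S x -> W (h x) /\ g (h x) = f x.

Lemma lifts_on_projective V (S : set V) (hS : submodule S) :
  lifts_on S -> is_projective (submod hS).
Proof.
move=> lS M N g f gs.
pose f' (x : V) := if pselect (S x) is left Sx then f (mksubmod hS Sx) else 0.
have f'E (x : submod hS) : f' (submod_val x) = f x.
  rewrite /f'; case: pselect => [Sx|/(_ (submodP x))//].
  by congr (f _); exact: submod_inj.
have f'Es x (Sx : S x) : f' x = f (mksubmod hS Sx) by exact: (f'E (mksubmod hS Sx)).
have [|x Sx|h [hl hP]] := lS M N g setT f' (submodule_setT M).
- move=> a x y Sx Sy.
  have Sxy : S (a *: x + y) by exact: hS.2.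
  rewrite !f'Es -linearP; congr (f _); exact: submod_inj.
- by have [y <-] := gs (f' x); exists y.
have h'l : linear (fun x : submod hS => h (submod_val x)).
  by move=> a x y; rewrite -hl//; exact: submodP.
exists (mklinear h'l) => x /=.
by have [_ ->] := hP _ (submodP x).
Qed.

Lemma lifts_on_projectiveT V : lifts_on (@setT V) -> is_projective V.
Proof.
move=> lV M N g f gs.
have [|x _|h [hl hP]] := lV M N g setT f (submodule_setT M).
- exact: linear_linear_on.
- by have [y <-] := gs (f x); exists y.
have h'l : linear h by move=> a x y; exact: hl.
by exists (mklinear h'l) => x; have [_ <-] := hP x I.
Qed.

Lemma lifts_on_retract V (S : set V) (r : {linear V -> V}) :
  lifts_on (@setT V) -> (forall x, S (r x)) -> (forall x, S x -> r x = x) ->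
  lifts_on S.
Proof.
move=> lV rS rK M N g W f hW fl gf.
have [||h [hl hP]] := lV M N g W (f \o r) hW.
- by move=> a x y _ _ /=; rewrite linearP fl//.
- by move=> x _ /=; exact: gf.
exists h; split=> [a x y _ _|x Sx]; first exact: hl.
by have [Wh ->] := hP x I; rewrite /= rK.
Qed.

Lemma lifts_on_image V W (D : {linear V -> W}) :
  injective D -> lifts_on (@setT V) -> lifts_on (range D).
Proof.
move=> Di lV M N g U f hU fl gf.
have [||h [hl hP]] := lV M N g U (f \o D) hU.
- by move=> a x y _ _ /=; rewrite linearP fl//; exact: imageT.
- by move=> x _ /=; apply: gf; exists x.
pose Di' (y : W) : V := xget 0 [set x | D x = y].
have DK x : Di' (D x) = x by apply: Di; exact: (@xgetPex _ 0 [set z | D z = D x] (ex_intro _ x erefl)).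
exists (h \o Di'); split=> [a _ _ [x _ <-] [y _ <-]|_ [x _ <-]] /=.
  by rewrite -linearP !DK hl.
by rewrite DK; exact: hP.
Qed.

Lemma lifts_on_prod V W :
  lifts_on (@setT V) -> lifts_on (@setT W) -> lifts_on (@setT (V * W)%type).
Proof.
move=> lV lW M N g U f hU fl gf.
have fD v w : f (v, w) = f (v, 0) + f (0, w).
  have -> : (v, w) = 1 *: (v, 0) + (0, w) :> V * W.
    by rewrite scale1r; congr pair; rewrite /= ?addr0 ?add0r.
  by rewrite fl// scale1r.
have [||h [hl hP]] := lV M N g U (fun v => f (v, 0)) hU.
- move=> a x y _ _; rewrite -fl//; congr f.
  by congr pair; rewrite /= scaler0 addr0.
- by move=> v _; exact: gf.
have [||k [kl kP]] := lW M N g U (fun w => f (0, w)) hU.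
- move=> a x y _ _; rewrite -fl//; congr f.
  by congr pair; rewrite /= scaler0 addr0.
- by move=> w _; exact: gf.
exists (fun vw => h vw.1 + k vw.2); split=> [a x y _ _|[v w] _] /=.
  by rewrite hl// kl// scalerDr addrACA.
have [Uh gh] := hP v I; have [Uk gk] := kP w I.
by split; [exact: (submoduleD hU)|rewrite linearD gh gk -fD].
Qed.

End Submodules.

(** * Finitely supported families and free modules *)

Section FinSupp.
Variables (R : nzRingType) (X : choiceType) (V : lmodType R).

Definition fsupp (w : X -> V) : set X := [set i | w i != 0].

Fact finite_fsupp_submodule : submodule [set w : X -> V | finite_set (fsupp w)].
Proof.
split=> [|a x y /= fx fy].
  by apply: (sub_finite_set _ (finite_set0 X)) => i /=; rewrite /fsupp/= eqxx.
apply: (@sub_finite_set _ _ (fsupp x `|` fsupp y)); last by rewrite finite_setU.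
move=> i; rewrite /fsupp /=.
change (a *: x i + y i != 0 -> x i != 0 \/ y i != 0).
by have [->|_] := eqVneq (x i) 0; [rewrite scaler0 add0r; right|left].
Qed.

(** The direct sum of copies of [V] indexed by [X]. With [V] equal to [R^o] it is a free module;
    with [{poly R}] it carries a family of telescopes. *)
Definition fsmod : lmodType R := submod finite_fsupp_submodule.

Definition entry (i : X) (w : fsmod) : V := submod_val w i.

Lemma entryP i a x y : entry i (a *: x + y) = a *: entry i x + entry i y.
Proof. by []. Qed.

Lemma entryZ i a x : entry i (a *: x) = a *: entry i x. Proof. by []. Qed.

Lemma entryB i x y : entry i (x - y) = entry i x - entry i y. Proof. by []. Qed.

Lemma entry_linear i : linear (entry i). Proof. by []. Qed.

HB.instance Definition _ i :=
  GRing.isLinear.Build R fsmod V *:%R (entry i) (entry_linear i).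

Definition supp (w : fsmod) : set X := fsupp (submod_val w).

Lemma finite_supp (w : fsmod) : finite_set (supp w).
Proof. exact: (submodP w). Qed.

Lemma suppP (w : fsmod) i : supp w i <-> entry i w <> 0.
Proof. by rewrite /supp /fsupp /=; split=> /eqP. Qed.

Lemma entry_eq0 (w : fsmod) i : ~ supp w i -> entry i w = 0.
Proof. by move=> /suppP/contrapT. Qed.

Lemma fsmodP (v w : fsmod) : (forall i, entry i v = entry i w) -> v = w.
Proof. by move=> vw; apply: submod_inj; apply: funext. Qed.

Lemma mkfsmod_subproof (f : X -> V) (A : set X) :
  finite_set A -> (forall i, ~ A i -> f i = 0) -> finite_set (fsupp f).
Proof.
move=> fA f0; apply: sub_finite_set fA => i /= /eqP fi.
by apply: contrapT => /f0.
Qed.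

Definition mkfsmod (f : X -> V) (A : set X) (fA : finite_set A)
    (f0 : forall i, ~ A i -> f i = 0) : fsmod :=
  mksubmod finite_fsupp_submodule (mkfsmod_subproof fA f0).

Lemma entry_mkfsmod f A fA f0 i : entry i (@mkfsmod f A fA f0) = f i.
Proof. by []. Qed.

Fact single_subproof (i : X) (v : V) (j : X) : ~ [set i] j -> (if j == i then v else 0 : V) = 0.
Proof. by move=> /= ji; case: eqP => // /ji. Qed.

Definition single (i : X) (v : V) : fsmod :=
  mkfsmod (finite_set1 i) (@single_subproof i v).

Lemma entry_single i v j : entry j (single i v) = if j == i then v else 0.
Proof. by []. Qed.

Lemma single_linear i : linear (single i).
Proof.
move=> a x y; apply: fsmodP => j; rewrite entryP !entry_single.
by case: eqP => // _; rewrite scaler0 addr0.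
Qed.

HB.instance Definition _ i :=
  GRing.isLinear.Build R V fsmod *:%R (single i) (single_linear i).

Lemma supp_single i v : supp (single i v) `<=` [set i].
Proof. by move=> j /suppP; rewrite entry_single; case: eqP. Qed.

Fact restr_subproof (B : set X) (w : fsmod) i :
  ~ supp w i -> (if i \in B then entry i w else 0) = 0.
Proof. by move=> /entry_eq0 ->; rewrite if_same. Qed.

Definition restr (B : set X) (w : fsmod) : fsmod :=
  mkfsmod (finite_supp w) (@restr_subproof B w).

Lemma entry_restr B w i : entry i (restr B w) = if i \in B then entry i w else 0.
Proof. by []. Qed.

Lemma restr_linear B : linear (restr B).
Proof.
move=> a x y; apply: fsmodP => i; rewrite entryP !entry_restr.
by case: ifP => _; rewrite ?entryP// scaler0 addr0.
Qed.

HB.instance Definition _ B :=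
  GRing.isLinear.Build R fsmod fsmod *:%R (restr B) (restr_linear B).

Lemma supp_restr B w : supp (restr B w) `<=` B.
Proof.
by move=> i /suppP; rewrite entry_restr; case: ifPn => // /set_mem.
Qed.

Lemma restr_id B w : supp w `<=` B -> restr B w = w.
Proof.
move=> wB; apply: fsmodP => i; rewrite entry_restr; case: ifPn => // iB.
by rewrite entry_eq0// => /wB /mem_set; apply/negP.
Qed.

Lemma submodule_supp B : submodule [set w | supp w `<=` B].
Proof.
split=> [i /suppP|a x y /= xB yB i /suppP]; first by rewrite linear0.
apply: contra_notP => Bi; rewrite entryP !entry_eq0 ?scaler0 ?addr0//.
- by move=> /yB.
- by move=> /xB.
Qed.

Section Ext.
Variables (M : lmodType R) (phi : X -> {linear V -> M}).

Definition fsext (w : fsmod) : M :=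
  \sum_(i \in [set: X]) phi i (entry i w).

Lemma fsextE (A : {fset X}) w : supp w `<=` [set` A] ->
  fsext w = \sum_(i <- A) phi i (entry i w).
Proof.
move=> wA; apply: fsbigTE => i iA; rewrite entry_eq0 ?linear0// => /wA/=.
exact/negP.
Qed.

Lemma fsext_linear : linear fsext.
Proof.
move=> a x y; have [A AE] : exists A : {fset X}, supp x `|` supp y = [set` A].
  by apply/finite_fsetP; rewrite finite_setU; split; exact: finite_supp.
rewrite !(@fsextE A).
- rewrite scaler_sumr -big_split; apply: eq_bigr => i _ /=.
  by rewrite !linearP.
- by move=> i; rewrite -AE => ?; right.
- by move=> i; rewrite -AE => ?; left.
- move=> i /suppP; rewrite -AE; apply: contra_notP => /not_orP[xi yi].
  by rewrite entryP !entry_eq0// scaler0 addr0.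
Qed.

HB.instance Definition _ :=
  GRing.isLinear.Build R fsmod M *:%R fsext fsext_linear.

Lemma fsext_single i v : fsext (single i v) = phi i v.
Proof.
rewrite (@fsextE [fset i]%fset) ?big_seq_fset1 ?entry_single ?eqxx// => j.
by move=> /supp_single ->; rewrite /= inE.
Qed.

Lemma fsext_in (S : set M) w : submodule S ->
  (forall i, supp w i -> S (phi i (entry i w))) -> S (fsext w).
Proof.
move=> hS wS; rewrite /fsext; have [A AE] := finite_fsetP.1 (finite_supp w).
rewrite -/(fsext w) (@fsextE A) ?AE// big_seq.
by apply: submodule_sum => // i iA; apply: wS; rewrite AE.
Qed.

End Ext.

Lemma fsmodE w : w = fsext (fun i => single i) w.
Proof.
apply: fsmodP => j; have [A AE] := finite_fsetP.1 (finite_supp w).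
rewrite (@fsextE _ _ A) ?AE// linear_sum /=.
have [jA|jA] := boolP (j \in A).
  rewrite (big_fsetD1 j)//= eqxx big_seq big1 ?addr0// => i.
  by rewrite !inE eq_sym => /andP[/negPf-> _].
rewrite big_seq big1 ?entry_eq0//; first by rewrite AE; exact/negP.
by move=> i iA; case: eqP => // ji; move: jA; rewrite ji iA.
Qed.

Lemma linear_fsmodE (M : lmodType R) (f : {linear fsmod -> M}) w :
  f w = fsext (fun i => f \o single i) w.
Proof.
rewrite {1}[w]fsmodE; have [A AE] := finite_fsetP.1 (finite_supp w).
by rewrite !(@fsextE _ _ A) ?AE// linear_sum.
Qed.

Lemma lifts_on_fsmod : lifts_on (@setT V) -> lifts_on (@setT fsmod).
Proof.
move=> lV M N g W f hW fl gf.
have /choice[h hP] : forall i, exists h : {linear V -> M},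
    forall v, W (h v) /\ g (h v) = f (single i v).
  move=> i; have [||h [hl hP]] := lV M N g W (f \o single i) hW.
  - by move=> a x y _ _ /=; rewrite linearP fl.
  - by move=> x _; exact: gf.
  have hl' : linear h by move=> a x y; exact: hl.
  by exists (mklinear hl') => v; exact: hP.
have fl' : linear f by move=> a x y; exact: fl.
exists (fsext h); split=> [|w _]; first exact: linear_linear_on.
split; first by apply: fsext_in => // i _; exact: (hP i _).1.
rewrite -[f]/(mklinear fl' : _ -> _) [RHS]linear_fsmodE.
have [A AE] := finite_fsetP.1 (finite_supp w).
rewrite !(@fsextE _ _ A) ?AE// linear_sum; apply: eq_bigr => i _.
exact: (hP i _).2.
Qed.

Lemma linear_fsext (M N : lmodType R) (h : {linear M -> N})
    (phi : X -> {linear V -> M}) w :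
  h (fsext phi w) = fsext (fun i => h \o phi i) w.
Proof.
have [A AE] := finite_fsetP.1 (finite_supp w).
by rewrite !(@fsextE _ _ A) ?AE// linear_sum.
Qed.

Lemma eq_fsext (M : lmodType R) (phi psi : X -> {linear V -> M}) w :
  (forall i, supp w i -> phi i (entry i w) = psi i (entry i w)) ->
  fsext phi w = fsext psi w.
Proof.
move=> e; have [A AE] := finite_fsetP.1 (finite_supp w).
rewrite !(@fsextE _ _ A) ?AE// !big_seq; apply: eq_bigr => i iA.
by apply: e; rewrite AE.
Qed.

(** Coordinatewise solutions assemble into an element of the direct sum because 0 is a solution
    outside a finite set. The mapping-cone argument solves its equations this way. *)
Lemma fsmod_choice (A : set X) (P : X -> V -> Prop) : finite_set A ->
  (forall i, ~ A i -> P i 0) -> (forall i, exists v, P i v) ->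
  exists w, forall i, P i (entry i w).
Proof.
move=> fA P0 /choice[f fP]; pose g i := if i \in A then f i else 0.
have g0 i : ~ A i -> g i = 0 by move=> Ai; rewrite /g memNset.
exists (mkfsmod fA g0) => i; rewrite entry_mkfsmod /g.
by case: ifPn => [_|/negP Ai]; [exact: fP|apply: P0 => /mem_set].
Qed.

Section Map.
Variable f : X -> {linear V -> V}.

Fact fsmap_subproof (w : fsmod) i : ~ supp w i -> f i (entry i w) = 0.
Proof. by move=> /entry_eq0 ->; exact: linear0. Qed.

Definition fsmap (w : fsmod) : fsmod := mkfsmod (finite_supp w) (@fsmap_subproof w).

Lemma entry_fsmap i w : entry i (fsmap w) = f i (entry i w). Proof. by []. Qed.

Lemma fsmap_linear : linear fsmap.
Proof. by move=> a x y; apply: fsmodP => i; rewrite entryP !entry_fsmap linearP. Qed.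

HB.instance Definition _ := GRing.isLinear.Build R fsmod fsmod *:%R fsmap fsmap_linear.

Lemma fsext_fsmap (M : lmodType R) (phi : X -> {linear V -> M}) w :
  fsext phi (fsmap w) = fsext (fun i => phi i \o f i) w.
Proof.
have [A AE] := finite_fsetP.1 (finite_supp w).
rewrite !(@fsextE _ _ A) ?AE// -AE => i /suppP.
by apply: contra_notP => wi; rewrite entry_fsmap entry_eq0// linear0.
Qed.

End Map.

End FinSupp.

Section Free.
Variable R : nzRingType.

Definition freemod (X : choiceType) : lmodType R := fsmod X (R^o : lmodType R).

Fact scalel_linear (M : lmodType R) (m : M) :
  linear (fun a : (R^o : lmodType R) => (a : R) *: m).
Proof. by move=> a x y; rewrite scalerDl scalerA. Qed.

Definition scalel (M : lmodType R) (m : M) : {linear (R^o : lmodType R) -> M} :=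
  mklinear (scalel_linear m).

Definition gen (X : choiceType) (i : X) : freemod X := single i (1 : R^o).

Definition extend (X : choiceType) (M : lmodType R) (phi : X -> M) :
  {linear freemod X -> M} := fsext (fun i => scalel (phi i)).

Lemma extend_gen (X : choiceType) (M : lmodType R) (phi : X -> M) i : extend phi (gen i) = phi i.
Proof. by rewrite [LHS]fsext_single /= scale1r. Qed.

Lemma lifts_on_regular : lifts_on (@setT (R^o : lmodType R)).
Proof.
move=> M N g W f hW fl gf; have [m Wm gm] := gf 1 I.
exists (scalel m); split=> [|a _ /=]; first exact: linear_linear_on.
split; first exact: submoduleZ.
rewrite linearZ/= gm -[in RHS](mulr1 a).
have fl' : linear f by move=> b x y; exact: fl.
by rewrite -[f]/(mklinear fl' : _ -> _) -linearZ.
Qed.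

Lemma lifts_on_free (X : choiceType) : lifts_on (@setT (freemod X)).
Proof. exact/lifts_on_fsmod/lifts_on_regular. Qed.

Lemma supp_gen (X : choiceType) (i : X) : supp (gen i) `<=` [set i].
Proof. exact: supp_single. Qed.

End Free.

(** * Resolutions and filtrations *)

Section Resolutions.
Variable R : nzRingType.

(** The resolution is continued by zero modules; the last disjunction serves both length one, where
    [P2] is zero, and length two. *)
Lemma pd_le_of_resolution (M P0 P1 P2 : lmodType R)
    (e : {linear P0 -> M}) (d0 : {linear P1 -> P0}) (d1 : {linear P2 -> P1})
    (n : nat) :
  is_projective P0 -> is_projective P1 -> is_projective P2 ->
  (forall y, exists x, e x = y) ->
  (forall x, e x = 0 <-> exists y, d0 y = x) ->
  (forall x, d0 x = 0 <-> exists y, d1 y = x) ->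
  (forall x, d1 x = 0 -> x = 0) ->
  (n = 1%N /\ (forall x : P2, x = 0)) \/ n = 2%N ->
  pd_le M n.
Proof.
move=> p0 p1 p2 es ex0 ex1 ex2 nP.
pose Z : lmodType R := 'rV[R]_0.
have Z0 (z : Z) : z = 0 by apply/rowP; case.
pose P i := match i with 0 => P0 | 1 => P1 | 2 => P2 | _ => Z end.
pose d i : {linear P i.+1 -> P i} := match i with
  | 0 => d0 | 1 => d1 | 2 => (\0 : {linear Z -> P2}) | _ => (\0 : {linear Z -> Z})
  end.
exists P, e, d.
split=> //.
- case=> [|[|[|i]]] // M' N' g f _; exists (\0 : {linear Z -> M'}) => x /=.
  by rewrite (Z0 x) !linear0.
- case=> [|[|[|i]]] //.
  + by case: nP => [[->]|->].
  + by case: nP => [[_ P20] _|->].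
- case=> [|[|i]] x.
  + exact: ex1.
  + split; first by move/ex2 => ->; exists (0 : Z).
    by case=> y; rewrite /d /= => <-; exact: linear0.
  + split=> [_|_]; first by exists (0 : Z); case: i x => [|i] x; rewrite [RHS]Z0.
    by case: i x.
Qed.

End Resolutions.

(* A relative form of Auslander's filtration lemma: the lift on the union is  *)
(* assembled by recursion along the well-order, [h v = delta_a (v - rho_a v)  *)
(* + h (rho_a v)] with [a] the least index of a layer containing [v].         *)
Section Filtration.
Variables (R : nzRingType) (V : lmodType R) (T : Type) (t0 : T).
Variables (lt : T -> T -> Prop) (S : T -> set V) (rho : T -> V -> V).
Hypothesis lt_wf : well_founded lt.
Hypothesis lt_trans : forall a b c, lt a b -> lt b c -> lt a c.
Hypothesis lt_total : forall a b, [\/ lt a b, a = b | lt b a].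
Hypothesis S_submodule : forall a, submodule (S a).
Hypothesis S_mono : forall a b, lt a b -> S a `<=` S b.
Hypothesis S_lifts : forall a, lifts_on (S a).
Hypothesis rho_linear : forall a, linear_on (S a) (rho a).
Hypothesis rho_id : forall a b v, lt b a -> S b v -> rho a v = v.
Hypothesis rho_lt :
  forall a v, S a v -> rho a v = 0 \/ exists2 b, lt b a & S b (rho a v).

Local Lemma min_index (P : set T) :
  (exists a, P a) -> exists2 a, P a & forall b, P b -> a = b \/ lt a b.
Proof.
case=> a; elim/(well_founded_ind lt_wf): a => a IH Pa.
have [[b Pb ba]|nb] := pselect (exists2 b, P b & lt b a); first exact: (IH b).
exists a => // b Pb; have [|->|ba] := lt_total a b; [by right|by left|].
by case: nb; exists b.
Qed.

Lemma lifts_on_filtration : lifts_on (\bigcup_a S a).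
Proof.
move=> M N g W f hW fl gf.
have /choice[delta deltaP] : forall a, exists h : V -> M,
    linear_on (S a) h /\ forall x, S a x -> W (h x) /\ g (h x) = f x.
  move=> a; apply: S_lifts => // [c x y Sx Sy|x Sx].
    by apply: fl; exists a.
  by apply: gf; exists a.
have /choice[rank rankP] : forall v, exists a, (exists b, S b v) ->
    S a v /\ forall b, S b v -> a = b \/ lt a b.
  move=> v; have [/min_index[a Sa am]|nv] := pselect (exists b, S b v).
    by exists a.
  by exists t0 => /nv.
(* [rec] is available only below [a]. For [v] in [S a] of rank [a], the default 0 is reached only
   when [rho a v] is 0. *)
pose F a (rec : forall b, lt b a -> V -> M) (v : V) : M :=
  delta a (v - rho a v) +
  (if pselect (rho a v <> 0 /\ lt (rank (rho a v)) a) is left p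
   then rec _ p.2 (rho a v) else 0).
pose H := Fix lt_wf (fun=> V -> M) F.
have HE a : H a = F a (fun b _ => H b).
  rewrite /H Fix_eq// => b h h' hh'; congr F.
  by apply: functional_extensionality_dep => c;
    apply: functional_extensionality_dep => p; exact: hh'.
pose h v := H (rank v) v.
have rho0 a : rho a 0 = 0 by exact: (linear_on0 (S_submodule a)).
have delta0 a : delta a 0 = 0 by exact: (linear_on0 (S_submodule a) (deltaP a).1).
have h0 : h 0 = 0.
  by rewrite /h HE /F rho0 subr0 delta0 add0r; case: pselect => // -[].
(* The recursion equation holds for every layer containing [v]: if [a] is not the least one, [rho a]
   fixes [v] and the first term is [delta a 0]. *)
have hE a v : S a v -> h v = delta a (v - rho a v) + h (rho a v).
  move=> Sv; have [Sr rmin] := rankP v (ex_intro _ a Sv).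
  have [ra|ra] := rmin a Sv; last by rewrite (rho_id ra)// subrr delta0 add0r.
  rewrite {1}/h HE /F ra; congr (_ + _); case: pselect => [//|np].
  have [->//|[b ba Sb]] := rho_lt Sv.
  have [r0|/eqP rn0] := eqVneq (rho a v) 0; first by rewrite r0.
  case: np; split=> //; have [_ /(_ b Sb)[->//|rb]] := rankP _ (ex_intro _ b Sb).
  exact: lt_trans rb ba.
have rho_lt2 a x y : S a x -> S a y -> (rho a x = 0 /\ rho a y = 0) \/
    exists2 b, lt b a & S b (rho a x) /\ S b (rho a y).
  move=> /rho_lt[->|[b ba Sb]] /rho_lt[->|[c ca Sc]]; first by left.
  - by right; exists c => //; split=> //; exact: submodule0.
  - by right; exists b => //; split=> //; exact: submodule0.
  - right; have [bc|bc|cb] := lt_total b c.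
    + by exists c => //; split=> //; exact: S_mono bc _ Sb.
    + by exists b => //; split=> //; rewrite bc.
    + by exists b => //; split=> //; exact: S_mono cb _ Sc.
have rhoS a v : S a v -> S a (rho a v).
  move=> /rho_lt[->|[b ba Sb]]; first exact: submodule0.
  exact: S_mono ba _ Sb.
have rhoB a v : S a v -> S a (v - rho a v).
  by move=> Sv; apply: submoduleB => //; exact: rhoS.
have hl a : linear_on (S a) h.
  elim/(well_founded_ind lt_wf): a => a IH c x y Sx Sy.
  have Sxy : S a (c *: x + y) by exact: (S_submodule a).2.
  rewrite (hE a)// (hE a x)// (hE a y)// rho_linear//.
  have -> : c *: x + y - (c *: rho a x + rho a y) =
      c *: (x - rho a x) + (y - rho a y).
    by rewrite scalerBr opprD addrACA.
  rewrite (deltaP a).1; [|exact: rhoB|exact: rhoB].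
  have -> : h (c *: rho a x + rho a y) = c *: h (rho a x) + h (rho a y).
    have [[-> ->]|[b ba [Sbx Sby]]] := rho_lt2 a x y Sx Sy.
      by rewrite !h0 scaler0 addr0 h0 scaler0 addr0.
    exact: (IH b).
  by rewrite scalerDr addrACA.
have hP a v : S a v -> W (h v) /\ g (h v) = f v.
  elim/(well_founded_ind lt_wf): a v => a IH v Sv; rewrite (hE a)//.
  have Sd : S a (v - rho a v) by exact: rhoB.
  have [Wd gd] := (deltaP a).2 _ Sd.
  have [Wh gh] : W (h (rho a v)) /\ g (h (rho a v)) = f (rho a v).
    have [->|[b ba Sb]] := rho_lt Sv; last exact: IH ba _ Sb.
    rewrite h0 linear0; split; first exact: submodule0.
    have fa : linear_on (S a) f by move=> c x y Sx Sy; apply: fl; exists a.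
    by rewrite (linear_on0 (S_submodule a) fa).
  split; first exact: submoduleD.
  have fa : linear_on (S a) f by move=> c x y Sx Sy; apply: fl; exists a.
  by rewrite linearD gd gh -(linear_onD fa) ?subrK//; exact: rhoS.
exists h; split=> [c x y [a _ Sx] [b _ Sy]|v [a _ Sv]]; last exact: hP Sv.
have [ab|ab|ba] := lt_total a b.
- by apply: (hl b) => //; exact: S_mono ab _ Sx.
- by apply: (hl b) => //; rewrite -ab.
- by apply: (hl a) => //; exact: S_mono ba _ Sy.
Qed.

End Filtration.

(** * Ideals of a noetherian local domain *)

Section Ideals.
Variable R : comNzRingType.
Implicit Types (I J P m : set R).

Lemma is_ideal0 I : is_ideal I -> I 0. Proof. by case. Qed.

Lemma is_idealD I x y : is_ideal I -> I x -> I y -> I (x + y).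
Proof. by case=> _ + _; apply. Qed.

Lemma is_idealM I a x : is_ideal I -> I x -> I (a * x).
Proof. by case=> _ _; apply. Qed.

Lemma is_idealMr I a x : is_ideal I -> I x -> I (x * a).
Proof. by rewrite mulrC; exact: is_idealM. Qed.

Lemma is_idealN I x : is_ideal I -> I x -> I (- x).
Proof. by move=> hI Ix; rewrite -mulN1r; exact: is_idealM. Qed.

Lemma is_idealB I x y : is_ideal I -> I x -> I y -> I (x - y).
Proof. by move=> hI Ix Iy; apply: is_idealD => //; exact: is_idealN. Qed.

Lemma is_ideal_sum I (T : eqType) (r : seq T) (F : T -> R) : is_ideal I ->
  (forall i, i \in r -> I (F i)) -> I (\sum_(i <- r) F i).
Proof.
move=> hI IF; rewrite big_seq; apply: big_ind => //; first exact: is_ideal0.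
by move=> x y; exact: is_idealD.
Qed.

Lemma proper_idealP I : is_ideal I -> (I != setT) <-> ~ I 1.
Proof.
move=> hI; split=> [/eqP IT I1|I1]; last by apply/eqP => IT; rewrite IT in I1; exact: I1.
by apply: IT; apply/seteqP; split=> // x _; rewrite -[x]mulr1; exact: is_idealM.
Qed.

Lemma ideal_span_ideal (A : set R) : is_ideal (ideal_span A).
Proof.
split.
- by exists [::]; rewrite big_nil; split.
- move=> _ _ [s [sA ->]] [t [tA ->]]; exists (s ++ t); rewrite big_cat; split=> // p.
  by rewrite mem_cat => /orP[/sA|/tA].
- move=> a _ [s [sA ->]]; exists [seq (a * p.1, p.2) | p <- s]; split.
    by move=> _ /mapP[p /sA Ap ->].
  by rewrite big_map mulr_sumr; apply: eq_bigr => p _; rewrite mulrA.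
Qed.

Lemma ideal_span_sub (A : set R) : A `<=` ideal_span A.
Proof.
move=> x Ax; exists [:: (1, x)]; rewrite big_seq1 mul1r; split=> // p.
by rewrite inE => /eqP ->.
Qed.

Lemma ideal_span_min (A : set R) I : is_ideal I -> A `<=` I -> ideal_span A `<=` I.
Proof.
by move=> hI AI _ [s [sA ->]]; apply: is_ideal_sum => // p /sA /AI; exact: is_idealM.
Qed.

Lemma noetherian_acc (J : nat -> set R) : noetherian R ->
  (forall n, is_ideal (J n)) -> (forall n, J n `<=` J n.+1) ->
  exists N, forall n, J n `<=` J N.
Proof.
move=> noeth hJ Jincr.
have Jmono n k : (n <= k)%N -> J n `<=` J k.
  elim: k => [|k IH]; first by rewrite leqn0 => /eqP ->.
  rewrite leq_eqVlt => /predU1P[->//|/ltnSE/IH nk].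
  exact: subset_trans nk (Jincr k).
have hU : is_ideal (\bigcup_n J n).
  split=> [|x y [n _ Jx] [k _ Jy]|a x [n _ Jx]].
  - by exists 0%N => //; exact: is_ideal0.
  - exists (maxn n k) => //; apply: is_idealD => //.
      exact: Jmono (leq_maxl n k) _ Jx.
    exact: Jmono (leq_maxr n k) _ Jy.
  - by exists n => //; exact: is_idealM.
have [s sE] := noeth _ hU.
have [N sN] : exists N, forall x, x \in s -> J N x.
  have : forall x, x \in s -> exists n, J n x.
    move=> x xs; have : (\bigcup_n J n) x by rewrite sE; exact: ideal_span_sub.
    by case=> n _ Jx; exists n.
  elim: {sE} s => [|x s IH] sJ; first by exists 0%N.
  have [|N sN] := IH; first by move=> y ys; apply: sJ; rewrite inE ys orbT.
  have [n Jx] := sJ x (mem_head _ _); exists (maxn n N) => y.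
  rewrite inE => /predU1P[->|/sN JN]; first exact: Jmono (leq_maxl n N) _ Jx.
  exact: Jmono (leq_maxr n N) _ JN.
exists N => n x Jx; suff: ideal_span [set` s] `<=` J N.
  by apply; rewrite -sE; exists n.
exact: ideal_span_min.
Qed.

(** The ideals [J n] of those [a] with [s ^+ n * a] in [(y, t)] increase, hence stabilize at some
    [N]. Writing [y = s ^+ N.+1 * a + t * b], the element [a] lies in [J N], so [y] is
    [s * (y * c + t * d) + t * b]; since [1 - s * c] is invertible, [y] is a multiple of [t]. *)
Lemma krull_principal (s t y : R) : noetherian R ->
  (forall c, exists d, d * (1 - s * c) = 1) ->
  (forall n, exists a b, y = s ^+ n * a + t * b) -> exists z, y = t * z.
Proof.
move=> noeth s_rad yn.
pose J n : set R := [set a | exists c d, s ^+ n * a = y * c + t * d].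
have hJ n : is_ideal (J n).
  split=> [|a b [c [d e]] [c' [d' e']]|a b [c [d e]]].
  - by exists 0, 0; rewrite !mulr0 addr0.
  - by exists (c + c'), (d + d'); rewrite !mulrDr e e' addrACA.
  - by exists (a * c), (a * d); rewrite mulrCA e mulrDr !(mulrCA a).
have [|N JN] := noetherian_acc noeth hJ.
  move=> n a [c [d e]]; exists (s * c), (s * d).
  by rewrite exprS -mulrA e mulrDr !(mulrCA s).
have [a [b yE]] := yn N.+1.
have [|c [d e]] := JN N.+1 a; first by exists 1, (- b); rewrite mulr1 mulrN yE addrK.
have [u uE] := s_rad c; exists (u * (s * d + b)).
rewrite -[LHS]mul1r -uE mulrCA -mulrA; congr (u * _).
have {}yE : y = s * (y * c + t * d) + t * b by rewrite -e mulrA -exprS.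
by rewrite mulrBl mul1r {1}yE; ring.
Qed.

Lemma ex_maximal_avoiding I x : is_ideal I -> (forall n, ~ I (x ^+ n)) ->
  exists P, [/\ is_ideal P, I `<=` P, forall n, ~ P (x ^+ n) &
    forall J, is_ideal J -> P `<=` J -> (forall n, ~ J (x ^+ n)) -> J = P].
Proof.
move=> hI Ix.
(* Zorn is applied to sets whose union with [I] is admissible, so that the empty chain is also
   bounded: its union gives back [I]. *)
pose Q : set (set R) :=
  [set A | is_ideal (A `|` I) /\ forall n, ~ (A `|` I) (x ^+ n)].
have [F FQ Ftot|A [[hA Ax] Amax]] := @Zorn_bigcup _ Q.
  pose U : set R := \bigcup_(X in F) X.
  have UE z : (U `|` I) z -> I z \/ exists2 A, F A & (A `|` I) z.
    by case=> [[A FA Az]|Iz]; [right; exists A => //; left|left].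
  have subU A : F A -> A `|` I `<=` U `|` I.
    by move=> FA z [Az|Iz]; [left; exists A|right].
  split; last first.
    move=> n /UE[/Ix//|[A FA Axn]]; exact: (FQ A FA).2 Axn.
  split; first by right; exact: is_ideal0.
  - move=> y z /UE[Iy|[A FA Ay]] /UE[Iz|[B FB Bz]].
    + by right; exact: is_idealD.
    + by apply: (subU B) => //; apply: is_idealD (FQ B FB).1 _ Bz; right.
    + by apply: (subU A) => //; apply: is_idealD (FQ A FA).1 Ay _; right.
    + have [AB|BA] := Ftot A B FA FB.
        apply: (subU B) => //; apply: is_idealD (FQ B FB).1 _ Bz.
        by case: Ay => [Ay|Ay]; [left; exact: AB|right].
      apply: (subU A) => //; apply: is_idealD (FQ A FA).1 Ay _.
      by case: Bz => [Bz|Bz]; [left; exact: BA|right].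
  - move=> a y /UE[Iy|[A FA Ay]]; first by right; exact: is_idealM.
    by apply: (subU A) => //; exact: is_idealM (FQ A FA).1 Ay.
exists (A `|` I); split=> // J hJ AJ Jx.
have JI : J `|` I = J by apply/setUidl => y Iy; apply: AJ; right.
apply: contrapT => JA; apply: (Amax J); last by split; rewrite JI.
split=> [|JsA]; first by move=> y Ay; apply: AJ; left.
by apply: JA; apply/seteqP; split=> // y /JsA; left.
Qed.

(** An ideal [P] maximal among those avoiding the powers of [x] is prime: each of two elements
    outside [P] has a multiple congruent to a power of [x] modulo [P], and so does their product. *)
Lemma ex_prime_avoiding I x : is_ideal I -> (forall n, ~ I (x ^+ n)) ->
  exists P, [/\ is_prime_ideal P, I `<=` P & forall n, ~ P (x ^+ n)].
Proof.
move=> hI Ix; have [P [hP IP Px Pmax]] := ex_maximal_avoiding hI Ix.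
exists P; split=> //; split.
  by split=> //; apply/proper_idealP => //; exact: (Px 0%N).
have grow a : ~ P a -> exists n b c, x ^+ n = b + c * a /\ P b.
  move=> Pa; apply: contrapT => noxn; apply: Pa.
  pose J : set R := [set y | exists b c, y = b + c * a /\ P b].
  have <- : J = P.
    apply: Pmax => [|y Py|n [b [c [e Pb]]]].
    - split=> [|_ _ [b [c [-> Pb]]] [b' [c' [-> Pb']]]|d _ [b [c [-> Pb]]]].
      + by exists 0, 0; rewrite mul0r addr0; split=> //; exact: is_ideal0.
      + by exists (b + b'), (c + c'); rewrite mulrDl addrACA; split=> //; exact: is_idealD.
      + by exists (d * b), (d * c); rewrite mulrDr mulrA; split=> //; exact: is_idealM.
    - by exists y, 0; rewrite mul0r addr0.
    - by apply: noxn; exists n, b, c.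
  by exists 0, 1; rewrite mul1r add0r; split=> //; exact: is_ideal0.
move=> a b Pab; apply: contrapT => /not_orP[/grow[n [c [d [e Pc]]]] /grow[k [c' [d' [e' Pc']]]]].
apply: (Px (n + k)%N); rewrite exprD e e' mulrDl; apply: is_idealD => //.
  exact: is_idealMr.
rewrite mulrDr; apply: is_idealD => //; first exact: is_idealM.
by rewrite mulrACA; exact: is_idealM.
Qed.

Lemma proper_ideal_sub_local m I : is_local m -> is_ideal I -> ~ I 1 -> I `<=` m.
Proof.
move=> [_ m_uniq] hI I1.
(* Avoiding the powers of 1 means being proper, so this [P] is a maximal ideal. *)
have [|P [hP IP Px Pmax]] := @ex_maximal_avoiding I 1 hI.
  by move=> n; rewrite expr1n.
suff <- : P = m by [].
apply: m_uniq; split.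
  by split=> //; apply/proper_idealP => //; rewrite -(expr0 1); exact: Px.
move=> J [hJ /(proper_idealP hJ) J1] PJ; apply: Pmax => // n.
by rewrite expr1n.
Qed.

Lemma local_ideal_is_ideal m : is_local m -> is_ideal m.
Proof. by case=> [[[]]]. Qed.

Lemma local_ideal1 m : is_local m -> ~ m 1.
Proof. by case=> [[[hm /(proper_idealP hm)]]]. Qed.

Lemma prime_ideal_expr P x n : is_prime_ideal P -> P (x ^+ n) -> P x.
Proof.
move=> [[hP /(proper_idealP hP) P1] Pmul].
by elim: n => [/P1//|n IH]; rewrite exprS => /Pmul[//|/IH].
Qed.

Lemma prime_sub_local m P : is_local m -> is_prime_ideal P -> P `<=` m.
Proof.
move=> mloc [[hP /(proper_idealP hP) P1] _]; exact: proper_ideal_sub_local.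
Qed.

End Ideals.

(** * Krull intersection and dimension arguments in local domains *)

Section LocalDomain.
Variable R : idomainType.
Implicit Types (I J P m : set R).

Definition rdvd (a b : R) : Prop := exists c, b = c * a.

Definition principal (a : R) : set R := rdvd a.

Lemma rdvd_refl a : rdvd a a. Proof. by exists 1; rewrite mul1r. Qed.

Lemma rdvd_trans b a c : rdvd a b -> rdvd b c -> rdvd a c.
Proof. by move=> [x ->] [y ->]; exists (y * x); rewrite mulrA. Qed.

Lemma rdvd_mull a b c : rdvd a b -> rdvd a (c * b).
Proof. by move=> [x ->]; exists (c * x); rewrite mulrA. Qed.

Lemma rdvd_mulr a b c : rdvd a b -> rdvd a (b * c).
Proof. by rewrite mulrC; exact: rdvd_mull. Qed.

Lemma principal_ideal a : is_ideal (principal a).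
Proof.
split=> [|_ _ [x ->] [y ->]|b _ [x ->]]; first by exists 0; rewrite mul0r.
  by exists (x + y); rewrite mulrDl.
by exists (b * x); rewrite mulrA.
Qed.

Lemma zero_prime : is_prime_ideal [set 0 : R].
Proof.
have h0 : is_ideal [set 0 : R].
  split=> // [_ _ -> ->|a _ ->]; first by rewrite /= addr0.
  by rewrite /= mulr0.
split; first by split=> //; apply/(proper_idealP h0)/eqP/oner_neq0.
by move=> x y /eqP; rewrite mulf_eq0 => /orP[/eqP|/eqP]; [left|right].
Qed.

Section Local.
Variables (m : set R) (mloc : is_local m).
Let hm := local_ideal_is_ideal mloc.

Lemma local_unitP x : x \is a GRing.unit <-> ~ m x.
Proof.
split=> [ux mx|mx].
  by apply: (local_ideal1 mloc); rewrite -(mulVr ux); exact: is_idealM.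
apply: contrapT => nux; apply: mx.
apply: (proper_ideal_sub_local mloc (principal_ideal x)); last exact: rdvd_refl.
by case=> c /esym cx; apply: nux; apply/unitrPr; exists c; rewrite mulrC.
Qed.

Lemma local_nonunitP x : x \isn't a GRing.unit <-> m x.
Proof.
split=> [|mx]; first by apply: contraNP => /local_unitP.
by apply/negP => /local_unitP.
Qed.

Lemma local_jacobson s c : m s -> 1 - s * c \is a GRing.unit.
Proof.
move=> ms; apply/local_unitP => m1; apply: (local_ideal1 mloc).
by rewrite -(subrK (s * c) 1); apply: is_idealD => //; exact: is_idealMr.
Qed.

Lemma local_prime : is_prime_ideal m.
Proof.
split; first by case: mloc => [[]].
move=> x y mxy; apply: contrapT => /not_orP[/local_unitP ux /local_unitP uy].
by apply/local_unitP: mxy; rewrite unitrM ux.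
Qed.

(** Krull's intersection theorem in [R / t]: principal ideals are closed in the [s]-adic topology.
    The case [t = 0] is separatedness. *)
Lemma krull_local s t y : noetherian R -> m s ->
  (forall n, exists a b, y = s ^+ n * a + t * b) -> rdvd t y.
Proof.
move=> noeth ms yn; have [|//|z ->] := @krull_principal R s t y noeth.
  by move=> c; exists (1 - s * c)^-1; rewrite mulVr//; exact: local_jacobson.
by exists z; rewrite mulrC.
Qed.

(** Otherwise a prime containing [y] but not [x] would fit strictly between 0 and [m]. *)
Lemma dim1_power x y : krull_dim R 1 -> m x -> y != 0 ->
  exists n, rdvd y (x ^+ n).
Proof.
move=> [_ dim1] mx y0; apply: contrapT => nxy.
have [|P [pP yP xP]] := ex_prime_avoiding (principal_ideal y) (x := x).
  by move=> n xn; apply: nxy; exists n.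
suff /dim1 : prime_chain R 2 by [].
exists (fun i => match i with 0 => [set 0] | 1 => P | _ => m end); split.
  by case=> [|[|[|]]]// _; [exact: zero_prime|exact: local_prime].
have Py : P y by exact/yP/rdvd_refl.
case=> [|[|]]// _; split.
- by move=> _ ->; apply: is_ideal0; case: pP => [[]].
- by move=> P0; move: y0; rewrite (P0 y Py) eqxx.
- exact: prime_sub_local.
- by move=> mP; apply: (xP 1%N); exact: mP.
Qed.

(** Otherwise a prime containing [y] and [p] but not [x] would fit strictly between [principal p]
    and [m], giving a chain of length three. In [R[1/x]] the elements [y] and [p ^+ k] are thus
    comaximal, which is what partial fractions require. *)
Lemma dim2_comaximal x y p k : krull_dim R 2 -> m x ->
  is_prime_ideal (principal p) -> p != 0 -> ~ rdvd p y ->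
  exists n a b, x ^+ n = a * y + b * p ^+ k.
Proof.
move=> [_ dim2] mx pp p0 py; apply: contrapT => nxy.
pose I : set R := [set z | exists a b, z = a * y + b * p ^+ k].
have hI : is_ideal I.
  split=> [|_ _ [a [b ->]] [c [d ->]]|e _ [a [b ->]]].
  - by exists 0, 0; rewrite !mul0r addr0.
  - by exists (a + c), (b + d); rewrite !mulrDl addrACA.
  - by exists (e * a), (e * b); rewrite mulrDr !mulrA.
have [|P [pP yP xP]] := ex_prime_avoiding hI (x := x).
  by move=> n [a [b e]]; apply: nxy; exists n, a, b.
have hP : is_ideal P by case: pP => [[]].
have Py : P y by apply: yP; exists 1, 0; rewrite mul1r mul0r addr0.
have Pp : P p.
  apply: (@prime_ideal_expr _ P p k pP).
  by apply: yP; exists 0, 1; rewrite mul1r mul0r add0r.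
suff /dim2 : prime_chain R 3 by [].
exists (fun i => match i with 0 => [set 0] | 1 => principal p | 2 => P | _ => m end).
split; first by case=> [|[|[|[|]]]]// _; [exact: zero_prime|exact: local_prime].
case=> [|[|[|]]]// _; split.
- by move=> _ ->; apply: is_ideal0; exact: principal_ideal.
- by move=> pz; move: p0; rewrite (pz p (rdvd_refl p)) eqxx.
- by move=> _ [c ->]; exact: is_idealM.
- by move=> Pz; apply: py; exact: Pz.
- exact: prime_sub_local.
- by move=> mP; apply: (xP 1%N); exact: mP.
Qed.

(** Suppose [m] is generated by [p] and take a chain of primes [c 0 < c 1 < c 2]. If [c 1] contains
    [p], it contains [c 2]; if not, each element of [c 1] is divisible by all powers of [p], hence
    zero. Both are absurd. *)
Lemma dim_gt1_nonprincipal p d : noetherian R -> krull_dim R d -> (1 < d)%N ->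
  m p -> exists2 x, m x & ~ rdvd p x.
Proof.
move=> noeth [[c [cp cs]] _] d1 mp; apply: contrapT => nx.
have mE x : m x -> rdvd p x by move=> mx; apply: contrapT => px; apply: nx; exists x.
have [p1 p2] : is_prime_ideal (c 1%N) /\ is_prime_ideal (c 2%N) by split; apply: cp => //; exact: ltnW.
have [s01 n10] := cs 0%N (ltnW d1); have [s12 n21] := cs 1%N d1.
have h1 : is_ideal (c 1%N) by case: p1 => [[]].
have [cpp|ncp] := pselect (c 1%N p).
  apply: n21 => x /(prime_sub_local mloc p2)/mE[a ->]; exact: is_idealM.
apply: n10 => x c1x; have -> : x = 0; last first.
  by apply: is_ideal0; have [] := cp 0%N isT => -[].
suff [z ->] : rdvd 0 x by rewrite mulr0.
apply: (krull_local noeth mp) => n; suff [a [-> _]] : exists a, x = p ^+ n * a /\ c 1%N a.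
  by exists a, 0; rewrite mulr0 addr0.
elim: n => [|n [a [-> c1a]]]; first by exists x; rewrite mul1r.
have [b e] := mE a (prime_sub_local mloc p1 c1a).
exists b; rewrite exprSr -mulrA e [b * p]mulrC; split=> //.
by move: c1a; rewrite e => /p1.2[].
Qed.

End Local.
End LocalDomain.

(** * Factorial and complete local domains *)

Section Factorial.
Variable R : idomainType.

Lemma rdvd_prod (s : seq R) q : q \in s -> rdvd q (\prod_(p <- s) p).
Proof.
move=> qs; rewrite (big_rem q)//=; exact/rdvd_mulr/rdvd_refl.
Qed.

Lemma irreducible_rdvd_sym (p q : R) :
  irreducible_elt p -> irreducible_elt q -> rdvd p q -> rdvd q p.
Proof.
move=> [_ nup _] [_ _ irrq] [c e]; have [uc|up] := irrq _ _ e; last by rewrite up in nup.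
by exists c^-1; rewrite e mulKr.
Qed.

Lemma prime_ideal_prod (P : set R) (s : seq R) : is_prime_ideal P ->
  P (\prod_(p <- s) p) -> exists2 q, q \in s & P q.
Proof.
move=> pP; have hP : is_ideal P by case: pP => [[]].
elim: s => [|q s IH]; first by rewrite big_nil; case: pP => [[_ /(proper_idealP hP)]].
rewrite big_cons => /pP.2[Pq|/IH[r rs Pr]].
  by exists q; rewrite ?mem_head.
by exists r; rewrite ?inE ?rs ?orbT.
Qed.

Hypothesis ufd : is_UFD R.

Lemma ufd_ex_irreducible_rdvd (x : R) : x != 0 -> x \isn't a GRing.unit ->
  exists2 p, irreducible_elt p & rdvd p x.
Proof.
move=> x0 ux; have [[|p s] [sirr xE]] := ufd.1 x x0 ux.
  by move: ux; rewrite xE big_nil unitr1.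
by exists p; [exact/sirr/mem_head|rewrite xE; exact/rdvd_prod/mem_head].
Qed.

Lemma irreducible_prime_ideal (p : R) :
  irreducible_elt p -> is_prime_ideal (principal p).
Proof.
move=> pirr; have [p0 up irrp] := pirr.
split.
  split; first exact: principal_ideal.
  apply/(proper_idealP (principal_ideal p)) => -[c /esym e].
  by move/negP: up; apply; apply/unitrPr; exists c; rewrite mulrC.
move=> a b [c e]; have [->|a0] := eqVneq a 0; first by left; exists 0; rewrite mul0r.
have [->|b0] := eqVneq b 0; first by right; exists 0; rewrite mul0r.
have [ua|ua] := boolP (a \is a GRing.unit).
  by right; exists (a^-1 * c); rewrite -mulrA -e mulKr.
have [ub|ub] := boolP (b \is a GRing.unit).
  by left; exists (c * b^-1); rewrite mulrAC -e mulrK.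
have [sa [sairr aE]] := ufd.1 a a0 ua; have [sb [sbirr bE]] := ufd.1 b b0 ub.
have c0 : c != 0 by apply: contra_neq (mulf_neq0 a0 b0) => c0; rewrite e c0 mul0r.
(* A factorization of [a * b = c * p] in which a unit multiple of [p] is visible. A unit [c] is
   absorbed into [p], since [is_UFD] factors only nonunits. *)
have [t [u [tirr uu pt tE]]] : exists t u, [/\ forall q, q \in t -> irreducible_elt q,
    u \is a GRing.unit, p * u \in t & \prod_(q <- t) q = a * b].
  have [uc|uc] := boolP (c \is a GRing.unit).
    exists [:: p * c], c; rewrite mem_head big_seq1 e mulrC; split=> // q.
    rewrite inE => /eqP ->; split; first exact: mulf_neq0.
      by rewrite unitrM negb_and uc (negPf up) ?orbT.
    move=> x y; rewrite mulrC => /(canRL (mulrK uc)); rewrite -mulrA => /irrp[]; first by left.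
    by rewrite unitrMl ?unitrV//; right.
  have [sc [scirr cE]] := ufd.1 c c0 uc.
  exists (p :: sc), 1; rewrite mulr1 mem_head unitr1 big_cons -cE e mulrC; split=> // q.
  by rewrite inE => /predU1P[->|/scirr].
have [||t' [tt' szt assoc]] := ufd.2 t (sa ++ sb) tirr.
- by move=> q; rewrite mem_cat => /orP[/sairr|/sbirr].
- by rewrite big_cat -aE -bE.
have [|v uv] := assoc (index (p * u) t); first by rewrite index_mem.
rewrite nth_index// => pv.
set q := t'`_(index (p * u) t) in pv.
have qt : q \in sa ++ sb.
  by rewrite (perm_mem tt') mem_nth// -szt index_mem.
have pq : rdvd p q.
  by exists (v^-1 * u); rewrite -[LHS](mulKr uv) -pv [p * u]mulrC mulrA.
by move: qt; rewrite mem_cat => /orP[/rdvd_prod|/rdvd_prod];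
  rewrite -?aE -?bE => /(rdvd_trans pq); [left|right].
Qed.

End Factorial.

(** * Limits of [s]-adically convergent sequences *)

Section Adic.
Variables (R : idomainType) (m : set R).
Hypothesis complete : adic_complete m.

Lemma ideal_pow_ideal n : is_ideal (ideal_pow m n).
Proof. exact: ideal_span_ideal. Qed.

Lemma ideal_pow_expr s n k c : m s -> (n <= k)%N -> ideal_pow m n (s ^+ k * c).
Proof.
move=> ms nk; rewrite -(subnKC nk) exprD -mulrA.
apply: (is_idealMr _ (ideal_pow_ideal n)); apply: ideal_span_sub.
by exists (fun=> s); rewrite prodr_const card_ord.
Qed.

(** Completeness is [m]-adic, while the conclusion asks for congruences modulo exact powers of [s].
    They come from taking a limit of the quotients of [u i - u j] by [s ^+ N j] and invoking
    uniqueness of limits. *)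
Lemma adic_limit (s : R) (u : nat -> R) (N : nat -> nat) : m s -> s != 0 ->
  (forall i, (N i < N i.+1)%N) ->
  (forall i, exists w, u i.+1 = u i + s ^+ N i * w) ->
  exists l, forall j, exists w, l = u j + s ^+ N j * w.
Proof.
move=> ms s0 Nincr ustep.
have Nmono i j : (i <= j)%N -> (N i + (j - i) <= N j)%N.
  elim: j => [|j IH]; first by rewrite leqn0 => /eqP ->; rewrite addn0.
  rewrite leq_eqVlt => /predU1P[->|ij]; first by rewrite subnn addn0.
  by rewrite subSn// addnS; apply: leq_ltn_trans (Nincr j); exact: IH.
have Nle i j : (i <= j)%N -> (N i <= N j)%N.
  by move=> /Nmono; exact: leq_trans (leq_addr _ _).
have uij i j : (i <= j)%N -> exists w, u j = u i + s ^+ N i * w.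
  elim: j => [|j IH].
    by rewrite leqn0 => /eqP ->; exists 0; rewrite mulr0 addr0.
  rewrite leq_eqVlt => /predU1P[->|ij]; first by exists 0; rewrite mulr0 addr0.
  have [w uj] := IH ij; have [w' ->] := ustep j.
  exists (w + s ^+ (N j - N i) * w'); rewrite uj mulrDr addrA mulrA -exprD subnKC//.
  exact: Nle.
have subuij i j : (i <= j)%N -> exists w, u j - u i = s ^+ N i * w.
  by move=> /uij[w ->]; exists w; rewrite addrAC subrr add0r.
have Ni i : (i <= N i)%N.
  by apply: leq_trans (Nmono 0%N i isT); rewrite subn0 leq_addl.
have pow0 n : s ^+ n != 0 by exact: expf_neq0.
have cauchy_unique (v : nat -> R) (M : nat -> nat) :
    (forall n, exists i, forall j, (i <= j)%N -> (n <= M j)%N) ->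
    (forall i j, (i <= j)%N -> exists w, v j - v i = s ^+ M i * w) ->
    exists! l, adic_cvg m v l.
  move=> Minf vij; apply: complete => n; have [i iM] := Minf n.
  exists i => j k ij ik; wlog jk : j k ij ik / (j <= k)%N.
    move=> hw; case/orP: (leq_total j k) => [|kj]; first exact: hw.
    by rewrite -opprB; apply: (is_idealN (ideal_pow_ideal n)); exact: hw.
  have [w e] := vij j k jk; rewrite -opprB e; apply: (is_idealN (ideal_pow_ideal n)).
  by apply: ideal_pow_expr => //; exact: iM.
have [l [ul l_uniq]] : exists! l, adic_cvg m u l.
  by apply: (cauchy_unique u N) => // n; exists n => j nj; exact: leq_trans nj (Ni j).
exists l => j.
have /choice[w wE] : forall i, exists w, (j <= i)%N -> u i = u j + s ^+ N j * w.
  move=> i; have [ij|_] := leqP j i; last by exists 0.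
  by have [w e] := uij j i ij; exists w.
(* The quotients are Cauchy because [s ^+ N j] can be cancelled in a domain. *)
have [w' [ww' _]] : exists! l, adic_cvg m (fun i => w (j + i)%N) l.
  apply: (cauchy_unique _ (fun i => (N (j + i) - N j)%N)) => [n|i k ik].
    exists n => i ni; rewrite leq_subRL ?Nle ?leq_addr//.
    by apply: leq_trans (Nmono _ _ (leq_addr i j)); rewrite leq_add2l addKn.
  have [|z zE] := subuij (j + i)%N (j + k)%N; first by rewrite leq_add2l.
  exists z; apply: (mulfI (pow0 (N j))); rewrite mulrA -exprD subnKC; last first.
    exact/Nle/leq_addr.
  by rewrite -zE (wE (j + k)%N) ?leq_addr// (wE (j + i)%N) ?leq_addr// mulrBr opprD addrACA subrr add0r.
exists w'; apply: l_uniq => n; have [i iP] := ww' n.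
exists (j + i)%N => k ik; have jk : (j <= k)%N by exact: leq_trans (leq_addr _ _) ik.
rewrite (wE k)// opprD addrACA subrr add0r -mulrBr.
apply: (is_idealM _ (ideal_pow_ideal n)); rewrite -(subnKC jk); apply: iP.
by rewrite -(leq_add2l j) subnKC.
Qed.

End Adic.

(** * Uncountably many primes, by Baire category *)

Section Baire.
Variables (R : idomainType) (m : set R) (d : nat).
Hypotheses (noeth : noetherian R) (mloc : is_local m) (complete : adic_complete m).
Hypotheses (dimR : krull_dim R d) (d_gt1 : (1 < d)%N) (ufd : is_UFD R).

(* Baire category in the [s]-adic topology: the closed sets [principal (e j)] *)
(* do not cover [m].                                                         *)
Lemma ex_avoiding_irreducibles (e : nat -> R) :
  (forall j, irreducible_elt (e j)) -> exists2 x, m x & forall j, ~ rdvd (e j) x.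
Proof.
move=> eirr; pose s := e 0%N; have sirr : irreducible_elt s by exact: eirr.
have [s0 us _] := sirr; have ms : m s by exact/(local_nonunitP mloc).
have [x0 mx0 sx0] := dim_gt1_nonprincipal mloc noeth dimR d_gt1 ms.
(* One approximation step: [y] refines [x] to precision [N], stays outside [s R], and the whole ball
   [y + s ^+ M R] misses [principal (e j)]. *)
pose good j (x : R) N (y : R) M := [/\ (N < M)%N, ~ rdvd s y,
  exists w, y = x + s ^+ N * w & forall z, ~ rdvd (e j) (y + s ^+ M * z)].
have step j (xN : R * nat) : exists yM : R * nat,
    ~ rdvd s xN.1 -> (0 < xN.2)%N -> good j xN.1 xN.2 yM.1 yM.2.
  case: xN => x N /=; have [sx|sx] := pselect (rdvd s x); first by exists (x, N).
  have [N0|N0] := posnP N; first by exists (x, N); rewrite N0.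
  have [y [yE sy ey]] : exists y, [/\ exists w, y = x + s ^+ N * w, ~ rdvd s y & ~ rdvd (e j) y].
    have [ex|ex] := pselect (rdvd (e j) x); last first.
      by exists x; split=> //; exists 0; rewrite mulr0 addr0.
    (* If [e j] divided both [x] and [x + s ^+ N], it would divide [s], hence be associated with it,
       and [s] would divide [x]. *)
    exists (x + s ^+ N); split; first by exists 1; rewrite mulr1.
      move=> ssN; apply: sx; rewrite -(addrK (s ^+ N) x).
      apply: (is_idealB (principal_ideal s)) => //.
      by rewrite -(prednK N0) exprS; exact/rdvd_mulr/rdvd_refl.
    move=> exsN; have esN : rdvd (e j) (s ^+ N).
      rewrite -(addKr x (s ^+ N)) addrC.
      exact: (is_idealB (principal_ideal (e j))).
    have es : rdvd (e j) s.
      have /irreducible_prime_ideal-/(_ ufd) pe := eirr j.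
      exact: prime_ideal_expr pe esN.
    by apply: sx; apply: rdvd_trans ex; exact: irreducible_rdvd_sym.
  (* Closedness of [principal (e j)] provides a ball around [y] that misses it. *)
  have [n nP] : exists n, forall a b, y <> s ^+ n * a + e j * b.
    apply: contrapT => nP; apply: ey; apply: (krull_local mloc noeth ms) => n.
    apply: contrapT => nab; apply: nP; exists n => a b yab.
    by apply: nab; exists a, b.
  exists (y, maxn n N.+1) => _ _; split=> //=; first by rewrite leq_max ltnSn orbT.
  move=> z [c cE]; apply: (nP (- (s ^+ (maxn n N.+1 - n) * z)) c).
  by rewrite mulrN mulrA -exprD subnKC ?leq_maxl// [e j * c]mulrC -cE addrC addrK.
have /choice[F FP] : forall jxN : nat * (R * nat), exists yM : R * nat,
    ~ rdvd s jxN.2.1 -> (0 < jxN.2.2)%N -> good jxN.1 jxN.2.1 jxN.2.2 yM.1 yM.2.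
  by move=> [j xN]; exact: step.
pose U := nat_rect (fun=> (R * nat)%type) (x0, 1%N) (fun j xN => F (j, xN)).
have UP j : ~ rdvd s (U j).1 /\ (0 < (U j).2)%N.
  elim: j => [//|j [sU NU]]; have [/= NM sU' _ _] := FP (j, U j) sU NU.
  by split=> //; exact: leq_ltn_trans NM.
have UPj j : good j (U j).1 (U j).2 (U j.+1).1 (U j.+1).2.
  by have [sU NU] := UP j; exact: FP (j, U j) sU NU.
have [||l lP] := @adic_limit R m complete s (fun j => (U j).1) (fun j => (U j).2) ms s0.
- by move=> i; case: (UPj i).
- by move=> i; case: (UPj i).
exists l; last by move=> j; have [w ->] := lP j.+1; case: (UPj j).
have [w ->] := lP 0%N; have hm := local_ideal_is_ideal mloc.
by apply: is_idealD => //; apply: is_idealMr => //=; rewrite expr1.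
Qed.

(** Only countably many irreducibles, up to associates, divide some [D n]. An element of [m]
    avoiding them all has an irreducible factor [p], yet [p] divides a product of values of [D],
    hence one of them. *)
Lemma uncountable_denominators (D : nat -> R) : (forall n, D n != 0) ->
  ~ (forall t, t != 0 -> exists s : seq nat, rdvd t (\prod_(i <- s) D i)).
Proof.
move=> D0 Ddvd; have hm := local_ideal_is_ideal mloc.
have /choice[fac facP] : forall n : nat, exists s : seq R,
    [/\ forall p, p \in s -> irreducible_elt p &
    forall p, irreducible_elt p -> rdvd p (D n) -> exists2 q, q \in s & rdvd q p].
  move=> n; have [uD|uD] := boolP (D n \is a GRing.unit).
    exists [::]; split=> // p [_ up _] [c /(congr1 (fun x => (D n)^-1 * x))].
    rewrite mulVr// => /esym; rewrite mulrA mulrC => e.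
    by exfalso; move/negP: up; apply; apply/unitrPr; exists ((D n)^-1 * c).
  have [s [sirr DE]] := ufd.1 _ (D0 n) uD; exists s; split=> // p pirr.
  have pp := irreducible_prime_ideal ufd pirr.
  rewrite DE => /(prime_ideal_prod pp)[q qs pq]; exists q => //.
  by apply: irreducible_rdvd_sym => //; exact: sirr.
have [p0 p0irr] : exists p : R, irreducible_elt p.
  have [x mx x0] := dim_gt1_nonprincipal mloc noeth dimR d_gt1 (is_ideal0 hm).
  have {}x0 : x != 0 by apply/eqP => xz; apply: x0; rewrite xz; exact: rdvd_refl.
  have [p pirr _] := ufd_ex_irreducible_rdvd ufd x0 ((local_nonunitP mloc _).2 mx).
  by exists p.
(* Enumerates the factors of all [D n] through codes of pairs; the default [p0] keeps every [e i]
   irreducible. *)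
pose e i := if @choice.unpickle (nat * nat)%type i is Some (n, k) then nth p0 (fac n) k else p0.
have eirr i : irreducible_elt (e i).
  rewrite /e; case: choice.unpickle => [[n k]|//].
  have [kn|kn] := ltnP k (size (fac n)); last by rewrite nth_default.
  by apply: (proj1 (facP n)); exact: mem_nth.
have [x mx ex] := ex_avoiding_irreducibles eirr.
have x0 : x != 0 by apply/eqP => x0; apply: (ex 0%N); rewrite x0; exists 0; rewrite mul0r.
have [p pirr px] := ufd_ex_irreducible_rdvd ufd x0 ((local_nonunitP mloc _).2 mx).
have [p_neq0 _ _] := pirr; have [s] := Ddvd p p_neq0.
rewrite -(big_map D xpredT id) /= => /(prime_ideal_prod (irreducible_prime_ideal ufd pirr)).
move=> [_ /mapP[n _ ->] pD]; have [q qn qp] := proj2 (facP n) p pirr pD.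
apply: (ex (choice.pickle (n, index q (fac n)))); rewrite /e choice.pickleK nth_index//.
exact: rdvd_trans px.
Qed.

End Baire.

(** * Quotient fields of projective dimension at most one *)

Section Countable.

Lemma countableU (U : Type) (A B : set U) :
  countable A -> countable B -> countable (A `|` B).
Proof.
move=> cA cB; rewrite -bigcup2inE.
by apply: bigcup_countable => // -[|[|]].
Qed.

Lemma countable_closure (U : Type) (op : U -> set U) (Z0 : set U) :
  countable Z0 -> (forall u, countable (op u)) ->
  exists Z : set U, [/\ countable Z, Z0 `<=` Z & forall u, Z u -> op u `<=` Z].
Proof.
move=> cZ0 cop.
pose next (Z : set U) := Z `|` \bigcup_(u in Z) op u.
pose Z := \bigcup_n iter n next Z0.
exists Z; split.
- apply: bigcup_countable => // n _; elim: n => [//|n IH] /=.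
  by apply: countableU => //; exact: bigcup_countable.
- by move=> u Zu; exists 0%N.
- by move=> u [n _ Zu] v vu; exists n.+1 => //; right; exists u.
Qed.

Lemma countable_enum (U : Type) (Z : set U) (u0 : U) : countable Z ->
  exists f : nat -> U, Z `<=` range f.
Proof.
move=> /countable_injP[g ginj].
have /choice[f fP] : forall n, exists u, (exists2 v, Z v & g v = n) -> Z u /\ g u = n.
  move=> n; have [[v Zv gv]|nv] := pselect (exists2 v, Z v & g v = n); first by exists v.
  by exists u0 => /nv.
exists f => u Zu; exists (g u) => //.
have [|Zf gf] := fP (g u); first by exists u.
by apply: ginj => //; rewrite inE.
Qed.

End Countable.

Section FractionModule.
Variable R : idomainType.
Local Notation Q := (fraction_module R).
Local Notation "x %:F" := (tofrac x).

Lemma fraction_scaleE (a : R) (x : Q) : a *: x = (a%:F : {fraction R}) * x.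
Proof. by []. Qed.

Lemma fractionP (x : {fraction R}) : exists a b : R, b != 0 /\ x = a%:F / b%:F.
Proof.
have [r ->] : exists r : {ratio R}, x = \pi_({fraction R})%qT r.
  by exists (repr x); rewrite reprK.
exists r.1, r.2; have r2 := denom_ratioP r; split=> //.
apply: (mulIf (x := r.2%:F)); first by rewrite tofrac_eq0.
rewrite mulfVK ?tofrac_eq0//.
rewrite !piE; apply/eqmodP; rewrite /= FracField.equivfE /FracField.mulf.
by rewrite !numden_Ratio ?mulf_neq0 ?oner_neq0// !mulr1 mulrC.
Qed.

Definition invQ (a : R) : Q := (a%:F : {fraction R})^-1.

Lemma scale_invQ a : a != 0 -> a *: invQ a = (1 : {fraction R}).
Proof. by move=> a0; rewrite fraction_scaleE divff ?tofrac_eq0. Qed.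

Lemma scale_invQM a b : a != 0 -> b != 0 -> a *: invQ (a * b) = invQ b.
Proof.
move=> a0 b0; rewrite fraction_scaleE /invQ tofracM invfM mulrA divff ?tofrac_eq0//.
by rewrite mul1r.
Qed.

End FractionModule.

Section ProjectiveDimension.
Variable R : idomainType.
Local Notation Q := (fraction_module R).
Local Notation "x %:F" := (tofrac x).

Definition lincomb (P : lmodType R) : {linear freemod R P -> P} := extend (fun x : P => x).

Lemma projective_section (P : lmodType R) : is_projective P ->
  exists i : {linear P -> freemod R P}, forall p, lincomb P (i p) = p.
Proof.
move=> pP; apply: (pP _ _ (lincomb P) (idfun : {linear P -> P})) => y.
by exists (gen R y); rewrite [LHS]extend_gen.
Qed.

Lemma lincomb_in (P : lmodType R) (S : set P) (w : freemod R P) : submodule S ->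
  (forall x, supp w x -> S x) -> S (lincomb P w).
Proof. by move=> hS wS; apply: fsext_in => // x /wS; exact: submoduleZ. Qed.

Lemma free_torsion (X : choiceType) (a : R) (w : freemod R X) :
  a != 0 -> a *: w = 0 -> w = 0.
Proof.
move=> a0 aw; apply: fsmodP => x; have /eqP := congr1 (entry x) aw.
by rewrite linearZ linear0 [_ == _]mulf_eq0 (negPf a0) => /eqP ->.
Qed.

Lemma free_divisible (X : choiceType) (a : R) (w : freemod R X) :
  (forall x, rdvd a (entry x w)) -> exists v, w = a *: v.
Proof.
move=> /choice[f fE].
pose g x : (R^o : lmodType R) := if x \in supp w then f x else 0.
have g0 x : ~ supp w x -> g x = 0 by move=> wx; rewrite /g memNset.
exists (mkfsmod (finite_supp w) g0); apply: fsmodP => x.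
rewrite entryZ entry_mkfsmod /g; case: ifPn => [_|/negP wx].
  by rewrite fE [LHS]mulrC.
by rewrite scaler0 entry_eq0// => /mem_set.
Qed.

Lemma restr_compl_eq0 (X : choiceType) (B : set X) (w : freemod R X) :
  restr (~` B) w = 0 <-> supp w `<=` B.
Proof.
split=> [w0 x wx|wB].
  apply: contrapT => Bx; move/suppP: wx; apply.
  by have := congr1 (entry x) w0; rewrite entry_restr linear0 mem_set.
apply: fsmodP => x; rewrite entry_restr linear0; case: ifPn => // /set_mem Bx.
by apply: entry_eq0 => /wB.
Qed.

Lemma supp_sub_restr_compl (X : choiceType) (B : set X) (w : freemod R X) :
  supp (w - restr (~` B) w) `<=` B.
Proof.
move=> x /suppP; apply: contra_notP => Bx; rewrite entryB entry_restr.
by rewrite mem_set// subrr.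
Qed.

(** A projective Q would embed in a free module. Let [a] be a nonzero coordinate of the image of 1;
    since 1 is [a * s] times an element of Q, [a * s] divides [a], and [s] is a unit. *)
Lemma fraction_pd_gt0 (s : R) : s != 0 -> s \isn't a GRing.unit -> ~ pd_le Q 0.
Proof.
move=> s0 us [P [e [d [Pproj P0 esurj ex0 _]]]].
have [i iK] := projective_section (Pproj 0%N).
have einj z : e z = 0 -> z = 0.
  by move=> /ex0[y <-]; rewrite (P0 1%N isT y) linear0.
have [z ez] := esurj (1 : {fraction R}).
have iz0 : i z <> 0.
  move=> iz; have : e z = 0 by rewrite -(iK z) iz !linear0.
  by rewrite ez => /eqP; rewrite oner_eq0.
have [x ax0] : exists x, entry x (i z) <> 0.
  apply: contrapT => nx; apply: iz0; apply: fsmodP => x; rewrite linear0.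
  by apply: contrapT => ix; apply: nx; exists x.
set a : R := entry x (i z) in ax0; have {}ax0 : a != 0 by apply/eqP.
have [z' ez'] := esurj (invQ (a * s)).
have zE : z = (a * s) *: z'.
  apply/eqP; rewrite -subr_eq0; apply/eqP/einj.
  by rewrite linearB linearZ /= ez ez' scale_invQ ?mulf_neq0// subrr.
move/negP: us; apply; apply/unitrPr; exists (entry x (i z') : R).
apply: (mulfI ax0); rewrite mulr1 mulrA {2}/a zE !linearZ.
by [].
Qed.

Lemma pd_le1P (M : lmodType R) : pd_le M 1 -> exists (P0 P1 : lmodType R)
    (e : {linear P0 -> M}) (d : {linear P1 -> P0}),
  [/\ is_projective P0, is_projective P1, forall y, exists x, e x = y,
      forall x, e x = 0 <-> exists y, d y = x & forall x, d x = 0 -> x = 0].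
Proof.
move=> [P [e [d [Pproj P0 esurj ex0 ex]]]].
exists (P 0%N), (P 1%N), e, (d 0%N); split=> // x /ex[y <-].
by rewrite (P0 2%N isT y) linear0.
Qed.

(* Kaplansky's argument: a quotient field of projective dimension at most one *)
(* over a local domain is countably generated.                               *)
Lemma fraction_pd1_countable (m : set R) (s : R) : noetherian R -> is_local m ->
  m s -> s != 0 -> pd_le Q 1 ->
  exists D : nat -> R, (forall n, D n != 0) /\
    forall t, t != 0 -> exists r : seq nat, rdvd t (\prod_(i <- r) D i).
Proof.
move=> noeth mloc ms s0 /pd_le1P[P0 [P1 [e [d [pP0 pP1 esurj ex dinj]]]]].
have [i0 i0K] := projective_section pP0; have [i1 i1K] := projective_section pP1.
have sn0 n : s ^+ n != 0 by exact: expf_neq0.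
(* [y n] lifts [1 / s ^+ n] to [P0], and [c n] below records in [P1] the failure of
   [s *: y n.+1 = y n]. *)
have /choice[y yE] : forall n, exists y, e y = invQ (s ^+ n) by move=> n.
have exB a b : e a = e b -> exists c, a = b + d c.
  move=> ab; have /ex[c cE] : e (a - b) = 0 by rewrite linearB ab subrr.
  by exists c; rewrite cE addrC subrK.
have /choice[c cE] : forall n, exists c, s *: y n.+1 = y n + d c.
  by move=> n; apply: exB; rewrite linearZ /= !yE exprS scale_invQM.
(* Elements of [P0] and [P1] index the bases of their free covers. Closing under [op] adds the basis
   elements needed to write [b] and, for [b] in [P1], also [d b]. *)
pose op (u : P0 + P1) : set (P0 + P1) := match u with
  | inl b => inl @` supp (i0 b)
  | inr b => inr @` supp (i1 b) `|` inl @` supp (i0 (d b)) end.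
pose Z0 : set (P0 + P1) := range (inl \o y) `|` range (inr \o c).
have cZ0 : countable Z0.
  apply: countableU;
    exact: sub_countable (card_image_le _ _) (countableP _).
have cop u : countable (op u).
  apply: finite_set_countable; case: u => b /=; last rewrite finite_setU; do ?split;
    by apply: finite_image; exact: finite_supp.
have [Z [cZ Z0Z Zop]] := countable_closure cZ0 cop.
pose B0 : set P0 := [set b | Z (inl b)]; pose B1 : set P1 := [set b | Z (inr b)].
pose S0 : set P0 := [set p | supp (i0 p) `<=` B0].
pose S1 : set P1 := [set p | supp (i1 p) `<=` B1].
have hS0 : submodule S0 by exact: (submodule_preimage i0 (submodule_supp _ B0)).
have hS1 : submodule S1 by exact: (submodule_preimage i1 (submodule_supp _ B1)).
have BS0 b : B0 b -> S0 b by move=> Bb x xb; apply: (Zop (inl b)) => //; exists x.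
have BS1 b : B1 b -> S1 b by move=> Bb x xb; apply: (Zop (inr b)) => //; left; exists x.
have dS b : S1 b -> S0 (d b).
  move=> Sb; rewrite -(i1K b).
  apply: (lincomb_in (submodule_preimage d hS0)) => x /Sb Bx z zx.
  by apply: (Zop (inr x)) => //; right; exists z.
have S0y n : S0 (y n) by apply: BS0; apply: Z0Z; left; exists n.
have S1c n : S1 (c n) by apply: BS1; apply: Z0Z; right; exists n.
have tel n : exists2 q, S1 q & s ^+ n *: y n = y 0%N + d q.
  elim: n => [|n [q Sq e_n]].
    by exists 0; [exact: submodule0|rewrite scale1r linear0 addr0].
  exists (q + s ^+ n *: c n); first exact: (submoduleD hS1 Sq (submoduleZ hS1 _ (S1c n))).
  by rewrite exprSr -scalerA cE scalerDr e_n linearD linearZ addrA.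
(* The coordinates outside the countable part: they embed [P0 / S0] and [P1 / S1] in free modules,
   so these quotients are torsion-free. *)
pose j0 (p : P0) := restr (~` B0) (i0 p); pose j1 (p : P1) := restr (~` B1) (i1 p).
have j0P p : j0 p = 0 <-> S0 p by exact: restr_compl_eq0.
have j1P p : j1 p = 0 <-> S1 p by exact: restr_compl_eq0.
have ZS0 (t : R) p : t != 0 -> S0 (t *: p) -> S0 p.
  move=> t0 /j0P jp; apply/j0P/(free_torsion t0).
  by rewrite -jp /j0 !linearZ.
have S1diff p : S1 (p - lincomb P1 (j1 p)).
  rewrite -{1}(i1K p) -linearB; apply: lincomb_in => // x xp; apply: BS1.
  exact: supp_sub_restr_compl xp.
(* The lift [z 0] of [1 / t] satisfies [t *: z 0 = y 0 + d (p 0)]. Modulo [S1], [p 0] is congruent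
   to [s ^+ n *: p n] up to multiples of [t], for every [n]; by Krull, [t] divides its outer
   coordinates. Subtracting the resulting boundary from [z 0] gives a lift in [S0]. *)
have gen0 (t : R) : t != 0 -> exists2 p, S0 p & e p = invQ t.
  move=> t0; have /choice[z zE] : forall n, exists z, e z = invQ (t * s ^+ n) by move=> n.
  have /choice[p pE] : forall n, exists p, t *: z n = y n + d p.
    by move=> n; apply: exB; rewrite linearZ /= zE yE scale_invQM.
  have /choice[q qE] : forall n, exists q, s ^+ n *: z n = z 0%N + d q.
    move=> n; apply: exB; rewrite linearZ /= !zE expr0 mulr1 [t * _]mulrC.
    by rewrite scale_invQM.
  have j1p x : rdvd t (entry x (j1 (p 0%N))).
    apply: (krull_local mloc noeth ms) => n; have [r Sr rE] := tel n.
    have p0E : p 0%N = (r + s ^+ n *: p n) - t *: q n.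
      have dE : d (r + s ^+ n *: p n) = d (p 0%N + t *: q n).
        apply: (addrI (y 0%N)); rewrite !linearD !linearZ /= !addrA -rE -(pE 0%N).
        by rewrite -!scalerDr -pE -qE !scalerA mulrC.
      apply/eqP; rewrite eq_sym subr_eq -subr_eq0; apply/eqP/dinj.
      by rewrite linearB dE subrr.
    exists (entry x (j1 (p n))), (- entry x (j1 (q n))).
    have jL a u v : j1 (a *: u + v) = a *: j1 u + j1 v by rewrite /j1 !linearP.
    have {}p0E : p 0%N = s ^+ n *: p n + ((- t) *: q n + r).
      by rewrite p0E scaleNr [- _ + r]addrC addrA [s ^+ n *: _ + r]addrC.
    rewrite p0E !jL; move/j1P: Sr => ->; rewrite addr0 entryP entryZ.
    by congr (_ + _); rewrite mulrN -mulNr.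
  have [w wE] := free_divisible j1p.
  exists (z 0%N - d (lincomb P1 w)).
    apply: (ZS0 t) => //; rewrite scalerBr pE -addrA; apply: (submoduleD hS0) => //.
    rewrite -linearZ -linearB; apply: dS; rewrite -linearZ -wE.
    exact: S1diff.
  rewrite linearB zE expr0 mulr1 [X in _ - X](_ : _ = 0) ?subr0//.
  by apply/ex; exists (lincomb P1 w).
have [f Zf] := countable_enum (inl 0) cZ.
have /choice[den denP] : forall x : Q, exists b : R, b != 0 /\ exists a : R, b *: x = a%:F.
  move=> x; have [a [b [b0 ->]]] := fractionP x; exists b; split=> //; exists a.
  by rewrite fraction_scaleE mulrC divfK// tofrac_eq0.
(* Denominators of the images in Q of the countably many basis elements; entries from [P1]
   contribute the harmless value 1. *)
pose D n := if f n is inl b then den (e b) else 1.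
exists D; split; first by move=> n; rewrite /D; case: (f n) => [b|_]; rewrite ?oner_eq0//; exact: (denP _).1.
move=> t t0; have [p Sp ep] := gen0 t t0.
pose N : set P0 := [set p | exists (r : seq nat) (a : R), (\prod_(i <- r) D i) *: e p = a%:F].
have hN : submodule N.
  split; first by exists [::], 0; rewrite linear0 scaler0 tofrac0.
  move=> a u v [r [b rE]] [r' [b' r'E]]; exists (r ++ r').
  exists (\prod_(i <- r') D i * a * b + \prod_(i <- r) D i * b').
  rewrite big_cat linearP scalerDr /= tofracD !tofracM -rE -r'E.
  rewrite !fraction_scaleE !tofracM; congr (_ + _); ring.
have [r [a rE]] : N p.
  rewrite -(i0K p); apply: lincomb_in => // x /Sp /Zf[n _ fn].
  by exists [:: n]; rewrite big_seq1 /D fn; exact: (denP _).2.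
exists r, a; apply/eqP; rewrite -tofrac_eq tofracM -rE ep fraction_scaleE /invQ.
by rewrite mulfVK// tofrac_eq0.
Qed.

End ProjectiveDimension.

(** * Countable localizations *)

Section PolynomialModule.
Variable R : idomainType.
Local Notation Q := (fraction_module R).
Local Notation L := ({poly R} : lmodType R).
Local Notation "x %:F" := (tofrac x).

Section PolyExt.
Variables (M : lmodType R) (mu : nat -> M).

(** Here [{poly R}] stands for the free module with basis ['X^n], and [mu] prescribes the images of
    the basis. *)
Definition polyext (p : L) : M := \sum_(i < size p) p`_i *: mu i.

Lemma polyextE n (p : L) : (size p <= n)%N -> polyext p = \sum_(i < n) p`_i *: mu i.
Proof.
move=> pn; rewrite /polyext (big_ord_widen n (fun i => p`_i *: mu i) pn) big_mkcond.
by apply: eq_bigr => i _; case: ltnP => // pi; rewrite nth_default// scale0r.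
Qed.

Fact polyext_linear : linear polyext.
Proof.
move=> a p q; pose n := maxn (size p) (size q).
rewrite !(@polyextE n) ?leq_maxl ?leq_maxr//; last first.
  apply: leq_trans (size_polyD _ _) _; rewrite geq_max leq_maxr andbT.
  exact: leq_trans (size_scale_leq _ _) (leq_maxl _ _).
rewrite scaler_sumr -big_split; apply: eq_bigr => i _ /=.
by rewrite coefD coefZ scalerDl scalerA.
Qed.

HB.instance Definition _ :=
  GRing.isLinear.Build R L M *:%R polyext polyext_linear.

Lemma polyextX n : polyext 'X^n = mu n.
Proof.
rewrite (@polyextE n.+1) ?size_polyXn// big_ord_recr /= coefXn eqxx scale1r.
by rewrite big1 ?add0r// => i _; rewrite coefXn ltn_eqF ?scale0r.
Qed.

Lemma polyext_in (S : set M) p : submodule S -> (forall n, S (mu n)) -> S (polyext p).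
Proof. by move=> hS Smu; apply: submodule_sum => // i _; exact: submoduleZ. Qed.

End PolyExt.

Lemma linear_polyE (M : lmodType R) (f : {linear L -> M}) p :
  f p = polyext (fun i => f 'X^i) p.
Proof.
rewrite -{1}(coefK p) poly_def linear_sum; apply: eq_bigr => i _.
by rewrite linearZ.
Qed.

Lemma lifts_on_poly : lifts_on (@setT L).
Proof.
move=> M N g W f hW fl gf.
have /choice[mu muP] : forall n : nat, exists y, W y /\ g y = f 'X^n.
  by move=> n; have [y Wy gy] := gf 'X^n I; exists y.
have fl' : linear f by move=> a x y; exact: fl.
exists (polyext mu); split=> [|p _]; first exact: linear_linear_on.
split; first by apply: polyext_in => // n; exact: (muP n).1.
rewrite -[f]/(mklinear fl' : _ -> _) [RHS]linear_polyE linear_sum.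
by apply: eq_bigr => i _; rewrite linearZ (muP i).2.
Qed.

(* The union of the chain [R 1/t_0 <= R 1/t_1 <= ...] is the cokernel of the  *)
(* injection ['X^n |-> 'X^n - s_n 'X^(n+1)] of {poly R}.                      *)
Section Telescope.
Variables (s t : nat -> R).
Hypotheses (t0 : forall n, t n != 0) (tS : forall n, t n.+1 = s n * t n).

Let s0 n : s n != 0.
Proof. by have := t0 n.+1; rewrite tS mulf_eq0 negb_or => /andP[]. Qed.

Definition tele (p : L) : L :=
  \poly_(i < (size p).+1) (p`_i - (if i is j.+1 then s j * p`_j else 0)).

Lemma coef_tele p i :
  (tele p)`_i = p`_i - (if i is j.+1 then s j * p`_j else 0).
Proof.
rewrite coef_poly ltnS; case: leqP => // pi; rewrite nth_default ?(ltnW pi)//.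
by case: i pi => // i pi; rewrite nth_default// mulr0 subrr.
Qed.

Fact tele_linear : linear tele.
Proof.
move=> a p q; apply/polyP => i; rewrite coefD coefZ !coef_tele.
case: i => [|i]; rewrite !coefD !coefZ ?subr0//.
by rewrite mulrDr mulrBr opprD addrACA mulrCA.
Qed.

HB.instance Definition _ := GRing.isLinear.Build R L L *:%R tele tele_linear.

Lemma tele_inj p : tele p = 0 -> p = 0.
Proof.
move=> tp; apply/polyP => i; rewrite coef0; elim: i => [|i IH].
  by have := coef_tele p 0; rewrite tp coef0 subr0 => <-.
by have := coef_tele p i.+1; rewrite tp coef0 IH mulr0 subr0 => <-.
Qed.

Definition tele_eval : {linear L -> Q} := polyext (fun n => invQ (t n)).

Lemma scale_invQS n : s n *: invQ (t n.+1) = invQ (t n).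
Proof. by rewrite tS scale_invQM. Qed.

Lemma tele_evalX n : tele_eval 'X^n = invQ (t n).
Proof. exact: polyextX. Qed.

Lemma tele_evalD p : tele_eval (tele p) = 0.
Proof.
have teleX n : tele 'X^n = ('X^n : L) - s n *: 'X^(n.+1).
  apply/polyP => i; rewrite coef_tele coefB coefZ !coefXn.
  case: i => [|i]; rewrite ?mulr0// ?coefXn eqSS; congr (_ - _).
  by case: eqP => [->|_]; rewrite ?mulr1 ?mulr0.
have -> : tele_eval (tele p) = polyext (fun n => tele_eval (tele ('X^n : L))) p.
  exact: (linear_polyE (tele_eval \o tele)).
apply: big1 => i _; rewrite teleX linearB linearZ /= !tele_evalX scale_invQS.
by rewrite subrr scaler0.
Qed.

Lemma tele_exact p : tele_eval p = 0 <-> exists q, tele q = p.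
Proof.
split=> [up|[q <-]]; last exact: tele_evalD.
(* [b n] is the numerator over [t n] of the sum of [p_k / t_k] for [k <= n]. It vanishes from the
   degree of [p] on, because the full sum is 0. *)
pose b := nat_rect (fun=> R) p`_0 (fun n bn => p`_n.+1 + s n * bn).
have bE n : b n *: invQ (t n) = \sum_(k < n.+1) p`_k *: invQ (t k).
  elim: n => [|n IH]; first by rewrite big_ord1.
  by rewrite big_ord_recr -IH /= scalerDl [s n * _]mulrC -scalerA scale_invQS addrC.
have b0 n : (size p <= n.+1)%N -> b n = 0.
  move=> pn; have := bE n; rewrite -(polyextE (fun k => invQ (t k)) pn) -/(tele_eval p) up.
  rewrite fraction_scaleE => /eqP; rewrite mulf_eq0 invr_eq0 !tofrac_eq0 (negPf (t0 n)).
  by rewrite orbF => /eqP.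
exists (\poly_(i < size p) b i).
have qE i : (\poly_(i < size p) b i)`_i = b i.
  by rewrite coef_poly; case: ltnP => // pi; rewrite b0// leqW.
apply/polyP => i; rewrite coef_tele !qE; case: i => [|i]; first by rewrite subr0.
by rewrite qE /= addrK.
Qed.

Lemma lifts_on_tele_ker : lifts_on [set p | tele_eval p = 0].
Proof.
have -> : [set p | tele_eval p = 0] = range tele.
  apply/seteqP; split=> [p /tele_exact[q <-]|_ [q _ <-]]; first by exists q.
  exact: tele_evalD.
apply: lifts_on_image lifts_on_poly => p q pq; apply/eqP; rewrite -subr_eq0.
by apply/eqP/tele_inj; rewrite linearB pq subrr.
Qed.

Lemma tele_pd : (forall x : Q, exists n a, x = a *: invQ (t n)) -> pd_le Q 1.
Proof.
move=> Qt; have Lproj := lifts_on_projectiveT lifts_on_poly.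
pose Z : lmodType R := 'rV[R]_0.
have Z0 (z : Z) : z = 0 by apply/rowP; case.
apply: (@pd_le_of_resolution R Q L L Z tele_eval tele \0) => //.
- by move=> M N g f _; exists \0 => x; rewrite (Z0 x) !linear0.
- by move=> x; have [n [a ->]] := Qt x; exists (a *: 'X^n); rewrite linearZ tele_evalX.
- exact: tele_exact.
- by move=> p; split=> [/tele_inj ->|[z <-]]; [exists 0|exact: linear0].
- by left.
Qed.

End Telescope.

Lemma dim1_pd (m : set R) (x : R) : is_local m -> krull_dim R 1 -> m x -> x != 0 ->
  pd_le Q 1.
Proof.
move=> mloc dim1 mx x0; apply: (@tele_pd (fun=> x) (fun n => x ^+ n)).
- by move=> n; exact: expf_neq0.
- by move=> n; exact: exprS.
move=> y; have [a [b [b0 ->]]] := fractionP y.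
have [n [c xn]] := dim1_power mloc dim1 mx b0; exists n, (a * c).
rewrite fraction_scaleE /invQ xn !tofracM -mulrA; congr (_ * _).
have c0 : c != 0 by have := expf_neq0 n x0; rewrite xn mulf_eq0 negb_or => /andP[].
by rewrite invfM mulrA divff ?tofrac_eq0// mul1r.
Qed.

End PolynomialModule.

(** * Partial fractions in dimension two *)

Section FactorialDim2.
Variables (R : idomainType) (m : set R) (x : R).
Hypotheses (noeth : noetherian R) (mloc : is_local m) (dim2 : krull_dim R 2).
Hypotheses (ufd : is_UFD R) (mx : m x) (x0 : x != 0).
Local Notation Q := (fraction_module R).
Local Notation L := ({poly R} : lmodType R).
Local Notation "x %:F" := (tofrac x).

(** For irreducible [p] the set chosen from depends only on the associate class, so associates
    receive the same representative. *)
Definition canonical_associate (p : R) : R :=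
  xget 0 [set q | irreducible_elt q /\ rdvd p q].

Lemma canonical_associateP p : irreducible_elt p ->
  irreducible_elt (canonical_associate p) /\ rdvd p (canonical_associate p).
Proof.
move=> pirr; rewrite /canonical_associate; case: xgetP => [q _ []//|/(_ p)].
by case; split=> //; exact: rdvd_refl.
Qed.

Lemma canonical_associate_eq p q : irreducible_elt p -> irreducible_elt q ->
  rdvd p q -> canonical_associate p = canonical_associate q.
Proof.
move=> pirr qirr pq; congr xget; apply/seteqP; split=> z [zirr zd]; split=> //.
  exact: rdvd_trans (irreducible_rdvd_sym pirr qirr pq) zd.
exact: rdvd_trans pq zd.
Qed.

Definition prime_rep : pred R :=
  fun p => `[< irreducible_elt p /\ canonical_associate p = p >].

Local Notation X := {p : R | prime_rep p}.

Lemma prime_repP (p : X) : irreducible_elt (val p).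
Proof. by case: p => p /= /asboolP[]. Qed.

Lemma prime_rep_neq0 (p : X) : val p != 0.
Proof. by have [] := prime_repP p. Qed.

Lemma prime_rep_prime (p : X) : is_prime_ideal (principal (val p)).
Proof. exact: irreducible_prime_ideal (prime_repP p). Qed.

Lemma prime_rep_inj (p q : X) : rdvd (val p) (val q) -> p = q.
Proof.
move=> pq; apply: val_inj => /=.
have := canonical_associate_eq (prime_repP p) (prime_repP q) pq.
by case: p {pq} => p /= /asboolP[_ ->]; case: q => q /= /asboolP[_ ->].
Qed.

Lemma ex_prime_rep p : irreducible_elt p -> exists q : X, rdvd p (val q) /\ rdvd (val q) p.
Proof.
move=> pirr; have [qirr pq] := canonical_associateP pirr.
have qp : prime_rep (canonical_associate p).
  apply/asboolP; split=> //.
  by rewrite -(canonical_associate_eq pirr qirr pq).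
by exists (@exist R (fun p => prime_rep p) _ qp); split=> //=; exact: irreducible_rdvd_sym.
Qed.

(** The lift to telescopes of the inclusion of [R[1/y]] in [R[1/(ya)]], since
    [1 / y^i = a^i / (y a)^i]. *)
Definition twist (a : R) (q : L) : L := \poly_(i < size q) (a ^+ i * q`_i).

Lemma coef_twist a q i : (twist a q)`_i = a ^+ i * q`_i.
Proof. by rewrite coef_poly; case: ltnP => // qi; rewrite nth_default// mulr0. Qed.

Fact twist_linear a : linear (twist a).
Proof.
move=> b p q; apply/polyP => i; rewrite coefD coefZ !coef_twist coefD coefZ.
by rewrite mulrDr mulrCA.
Qed.

HB.instance Definition _ a := GRing.isLinear.Build R L L *:%R (twist a) (twist_linear a).

Local Notation T y := (tele (fun=> y)).
Local Notation ev y := (tele_eval (fun n => y ^+ n)).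

Lemma tele_twist a y q : T (y * a) (twist a q) = twist a (T y q).
Proof.
apply/polyP => i; rewrite coef_twist !coef_tele coef_twist.
case: i => [|i]; rewrite ?subr0// coef_twist exprS; ring.
Qed.

Lemma eval_twist a y q : a != 0 -> y != 0 -> ev (y * a) (twist a q) = ev y q.
Proof.
move=> a0 y0; rewrite [RHS](linear_polyE (ev y)).
have -> : ev (y * a) (twist a q) = polyext (fun i => ev (y * a) (twist a ('X^i : L))) q.
  exact: (linear_polyE (ev (y * a) \o twist a)).
apply: eq_bigr => i _; congr (_ *: _) => /=.
have -> : twist a 'X^i = a ^+ i *: ('X^i : L).
  apply/polyP => j; rewrite coef_twist coefZ !coefXn.
  by case: eqP => [->|]//; rewrite !mulr0.
by rewrite linearZ /= !tele_evalX exprMn mulrC scale_invQM ?expf_neq0.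
Qed.

Lemma eval_denominator (y : R) (q : L) : y != 0 -> exists n a, y ^+ n *: ev y q = a%:F.
Proof.
move=> y0; pose S : set Q := [set z : Q | exists n (a : R), y ^+ n *: z = a%:F].
have hS : submodule S.
  split; first by exists 0%N, 0; rewrite scaler0 tofrac0.
  move=> a u v [n [b e]] [k [c e']]; exists (n + k)%N, (y ^+ k * a * b + y ^+ n * c).
  rewrite scalerDr tofracD !tofracM -e -e' !fraction_scaleE exprD tofracM.
  by congr (_ + _); ring.
apply: (polyext_in (mu := fun n => invQ (y ^+ n)) q hS) => n.
by exists n, 1; rewrite scale_invQ ?expf_neq0// tofrac1.
Qed.

Lemma eval_frac (y : R) (v : Q) n (a : R) : y != 0 -> y ^+ n *: v = a%:F ->
  exists q, ev y q = v.
Proof.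
move=> y0 e; exists (a *: 'X^n); rewrite linearZ /= tele_evalX.
rewrite fraction_scaleE -e fraction_scaleE /invQ mulrAC divff ?mul1r//.
by rewrite tofrac_eq0 expf_neq0.
Qed.

Lemma rdvd_expr_coprime (p w a : R) k : is_prime_ideal (principal p) -> p != 0 ->
  ~ rdvd p w -> rdvd (p ^+ k) (w * a) -> rdvd (p ^+ k) a.
Proof.
move=> pp p0 pw; elim: k a => [|k IH] a; first by exists a; rewrite mulr1.
move=> [c e]; have : rdvd p (w * a) by exists (c * p ^+ k); rewrite e exprSr mulrA.
move=> /pp.2[//|[b aE]]; have [|d bE] := IH b.
  exists c; apply: (mulIf p0); rewrite -mulrA -aE e exprSr; ring.
by exists d; rewrite aE bE exprSr; ring.
Qed.

Local Notation FX := (fsmod X L).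

Definition eval_sum (e : FX) : Q := fsext (fun p : X => ev (x * val p)) e.

(** All other terms of the vanishing sum have denominators prime to [p], so the term at [p] has no
    pole there and already lies in [R[1/x]]. *)
Lemma partial_fraction_unique (c : L) (e : FX) (p : X) :
  ev x c + eval_sum e = 0 -> exists b, ev x b = ev (x * val p) (entry p e).
Proof.
move=> ce0; have p0 := prime_rep_neq0 p; have pp := prime_rep_prime p.
have xp0 : x * val p != 0 by exact: mulf_neq0.
set v := ev _ _; have [n [a av]] := eval_denominator (entry p e) xp0.
(* If [p] divides [x], a denominator [(x * p) ^+ n] divides [x ^+ (n + n)]. *)
have [[y xE]|px] := pselect (rdvd (val p) x).
  apply: (@eval_frac x v (n + n) (y ^+ n * a)) => //.
  rewrite tofracM -av !fraction_scaleE -/v mulrA -tofracM; congr (_%:F * _).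
  by rewrite exprD {1}xE !exprMn; ring.
(* The localization of R at the prime generated by [p]. *)
pose S : set Q := [set z : Q | exists w, ~ rdvd (val p) w /\ exists b : R, w *: z = b%:F].
have hS : submodule S.
  split.
    exists 1; split; last by exists 0; rewrite scaler0 tofrac0.
    by have [[h /(proper_idealP h)]] := pp.
  move=> b u z [w [pw [d e1]]] [w' [pw' [d' e2]]]; exists (w * w').
  split; first by move=> /pp.2[].
  exists (w' * b * d + w * d').
  rewrite scalerDr tofracD !tofracM -e1 -e2 !fraction_scaleE !tofracM.
  by congr (_ + _); ring.
have Sev y q : y != 0 -> ~ rdvd (val p) y -> S (ev y q).
  move=> y0 py; have [k [b e1]] := eval_denominator q y0.
  by exists (y ^+ k); split; [move=> /(prime_ideal_expr pp)|exists b].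
have [w [pw [b wv]]] : S v.
  have -> : v = (-1) *: (ev x c + eval_sum (e - single p (entry p e))) + 0.
    rewrite addr0 scaleN1r /eval_sum linearB /= fsext_single addrA.
    by rewrite -/(eval_sum e) ce0 sub0r opprK.
  apply: hS.2; last exact: hS.1.
  apply: (submoduleD hS); first exact: Sev.
  apply: fsext_in => // q /suppP qe; have qp : q <> p.
    move=> qp; apply: qe; rewrite entryB entry_single qp eqxx subrr.
    by [].
  apply: Sev; first by rewrite mulf_neq0// prime_rep_neq0.
  by move=> /pp.2[//|/prime_rep_inj pq]; exact: qp.
have [a' aE] : rdvd (val p ^+ n) a.
  apply: (rdvd_expr_coprime pp p0 pw); exists (x ^+ n * b).
  apply/eqP; rewrite -tofrac_eq !tofracM -av -wv !fraction_scaleE exprMn !tofracM.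
  by apply/eqP; rewrite -/v; ring.
apply: (@eval_frac x v n a') => //.
have pn0 : (val p ^+ n)%:F != 0 by rewrite tofrac_eq0 expf_neq0.
apply: (mulIf pn0); rewrite -tofracM -aE -av -/v !fraction_scaleE exprMn tofracM.
by rewrite mulrAC.
Qed.

Definition eps (ce : L * FX) : Q := ev x ce.1 + eval_sum ce.2.

Fact eps_linear : linear eps.
Proof. by move=> a u v; rewrite /eps /eval_sum !linearP /= scalerDr addrACA. Qed.

HB.instance Definition _ := GRing.isLinear.Build R (L * FX)%type Q *:%R eps eps_linear.

(** It suffices to reach the inverses of nonzero [y]. Prime powers are split off one at a time: a
    relation [x ^+ N = a * y + b * p ^+ k] turns [1 / (y * p ^+ k)] into [a / p ^+ k + b / y],
    divided by [x ^+ N]. *)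
Lemma eps_surj v : exists ce, eps ce = v.
Proof.
pose S : set Q := range eps.
have hS : submodule S by exact: (submodule_image eps (submodule_setT _)).
have Sx n a : S (a *: invQ (x ^+ n)).
  exists (a *: 'X^n, 0) => //.
  by rewrite /eps /eval_sum linear0 addr0 linearZ /= tele_evalX.
have Sxp (p : X) n : S (invQ ((x * val p) ^+ n)).
  exists (0, single p 'X^n) => //.
  by rewrite /eps /eval_sum linear0 add0r fsext_single /= tele_evalX.
(* All powers of [x] are allowed in the denominator, as each splitting introduces more of them. *)
pose good (y : R) := y != 0 /\ forall n, S (invQ (x ^+ n * y)).
have goodU u y : u \is a GRing.unit -> good y -> good (u * y).
  move=> uu [y0 yS]; have u0 : u != 0 by apply: contraTneq uu => ->; rewrite unitr0.
  split=> [|n]; first exact: mulf_neq0.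
  have -> : invQ (x ^+ n * (u * y)) = u^-1 *: invQ (x ^+ n * y).
    rewrite mulrCA -[invQ (x ^+ n * y)](scale_invQM u0) ?mulf_neq0 ?expf_neq0//.
    by rewrite scalerA mulVr// scale1r.
  exact: submoduleZ.
have goodM (p y : R) k : is_prime_ideal (principal p) -> p != 0 -> ~ rdvd p y ->
    good y -> good (p ^+ k) -> good (y * p ^+ k).
  move=> pp p0 py [y0 yS] [pk0 pS]; split=> [|n]; first exact: mulf_neq0.
  have [N [a [b xN]]] := dim2_comaximal mloc k dim2 mx pp p0 py.
  have -> : invQ (x ^+ n * (y * p ^+ k)) =
      a *: invQ (x ^+ (n + N) * p ^+ k) + b *: invQ (x ^+ (n + N) * y).
    rewrite -(scale_invQM (a := x ^+ N)) ?mulf_neq0 ?expf_neq0//.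
    rewrite {1}xN scalerDl -!scalerA !mulrA -exprD [(N + n)%N]addnC; congr (_ *: _ + _ *: _).
      by rewrite [_ * y]mulrC -!mulrA scale_invQM// mulf_neq0 ?expf_neq0.
    by rewrite [_ * p ^+ k]mulrC scale_invQM// mulf_neq0 ?expf_neq0.
  by apply: submoduleD => //; exact: submoduleZ.
have goodP p k : irreducible_elt p -> good (p ^+ k).
  move=> pirr; have [p0 _ _] := pirr; split=> [|n]; first exact: expf_neq0.
  have [q [[c qE] _]] := ex_prime_rep pirr.
  have q0 := prime_rep_neq0 q.
  have c0 : c != 0 by move: q0; rewrite qE mulf_eq0 negb_or => /andP[].
  have -> : invQ (x ^+ n * p ^+ k) =
      (c ^+ k * (x ^+ k * val q ^+ n)) *: invQ ((x * val q) ^+ (n + k)).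
    have e1 : (x * val q) ^+ (n + k) =
        (c ^+ k * (x ^+ k * val q ^+ n)) * (x ^+ n * p ^+ k).
      by rewrite exprD !exprMn {2}qE exprMn; ring.
    by rewrite e1 scale_invQM ?mulf_neq0 ?expf_neq0.
  exact: submoduleZ.
(* Induction on a bound for the length: one step removes all associates of [p] together, and at
   least [p] itself. *)
have goodprod k (s : seq R) : (size s <= k)%N ->
    (forall p, p \in s -> irreducible_elt p) -> good (\prod_(p <- s) p).
  elim: k s => [|k IH] [|p s] // sk sirr; try by
    rewrite big_nil; split=> [|n]; [exact: oner_neq0|rewrite mulr1 -[invQ _]scale1r].
  have pirr : irreducible_elt p by apply: sirr; exact: mem_head.
  have [p0 _ _] := pirr; have pp := irreducible_prime_ideal ufd pirr.
  pose a (q : R) := `[< rdvd p q >].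
  rewrite (bigID a) /= -big_filter -[X in _ * X]big_filter.
  set s1 := filter a _; set s2 := filter _ _.
  have [u [uu uE]] : exists u, u \is a GRing.unit /\ \prod_(q <- s1) q = u * p ^+ (size s1).
    have : forall q, q \in s1 -> irreducible_elt q /\ rdvd p q.
      by move=> q; rewrite mem_filter => /andP[/asboolP pq /sirr].
    elim: (s1) => [|q r IHr] rP; first by exists 1; rewrite big_nil mulr1 unitr1.
    have [|u [uu rE]] := IHr; first by move=> z zr; apply: rP; rewrite inE zr orbT.
    have [[_ _ qirr] [w wE]] := rP q (mem_head _ _).
    have [_ up _] := pirr; have [uw|up'] := qirr _ _ wE; last by rewrite up' in up.
    exists (w * u); rewrite unitrM uw uu big_cons rE wE exprS; split=> //; ring.
  have s2E : good (\prod_(q <- s2) q).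
    apply: IH => [|q]; last by rewrite mem_filter => /andP[_ /sirr].
    rewrite /s2 /= ifF; last by apply/negbF/asboolP; exact: rdvd_refl.
    by rewrite size_filter (leq_trans (count_size _ _)).
  rewrite uE mulrAC -mulrA; apply: goodU => //.
  apply: goodM => //; last exact: goodP.
  by move=> /(prime_ideal_prod pp)[q]; rewrite mem_filter => /andP[/asboolP].
have goodall y : y != 0 -> good y.
  move=> y0; have [uy|uy] := boolP (y \is a GRing.unit).
    rewrite -[y]mulr1; apply: goodU => //; have := @goodprod 0%N [::] isT.
    by rewrite big_nil; apply.
  by have [s [sirr ->]] := ufd.1 y y0 uy; exact: goodprod (leqnn _) sirr.
have [a [b [b0 ->]]] := fractionP v; have [_ /(_ 0%N)] := goodall b b0.
rewrite mul1r => /(submoduleZ hS a)[ce _ e]; exists ce.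
by rewrite e.
Qed.

Let tele0 y (y0 : y != 0) (p : L) : T y p = 0 -> p = 0. Proof. exact: tele_inj. Qed.

Let teleP (y : R) (y0 : y != 0) (p : L) : ev y p = 0 <-> exists q, T y q = p.
Proof.
by apply: tele_exact => n; [exact: expf_neq0|exact: exprS].
Qed.

Let xp0 (p : X) : x * val p != 0.
Proof. by rewrite mulf_neq0 ?prime_rep_neq0. Qed.

Let total (b : FX) : L := fsext (fun _ : X => (idfun : {linear L -> L})) b.
Let Tx (b : FX) : FX := fsmap (fun _ : X => T x) b.
Let Txp (e : FX) : FX := fsmap (fun p : X => T (x * val p)) e.
Let tw (b : FX) : FX := fsmap (fun p : X => twist (val p)) b.

(* The mapping cone of the two-term resolutions of [R[1/x]^(X)] and of        *)
(* [R[1/x] + \bigoplus_p R[1/(xp)]].                                          *)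
Definition cone1 (bce : FX * (L * FX)) : L * FX :=
  (total bce.1 + T x bce.2.1, Txp bce.2.2 - tw bce.1).

Definition cone2 (a : FX) : FX * (L * FX) := (Tx a, (- total a, tw a)).

Fact cone1_linear : linear cone1.
Proof.
move=> a u v; rewrite /cone1 /total /Txp /tw !linearP /=; congr pair.
  by rewrite /= scalerDr addrACA.
by rewrite /= scalerBr scalerN addrACA.
Qed.

Fact cone2_linear : linear cone2.
Proof.
move=> a u v; rewrite /cone2 /total /Tx /tw !linearP /=.
by [].
Qed.

Let Txp_inj (u v : FX) : Txp u = Txp v -> u = v.
Proof.
move=> uv; apply: fsmodP => p; apply/eqP; rewrite -subr_eq0; apply/eqP.
apply: (tele0 (xp0 p)); rewrite linearB /=.
by have /(congr1 (entry p)) := uv; rewrite !entry_fsmap => ->; rewrite subrr.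
Qed.

Let total_Tx a : total (Tx a) = T x (total a).
Proof. by rewrite /total /Tx fsext_fsmap linear_fsext; exact: eq_fsext. Qed.

Let Txp_tw a : Txp (tw a) = tw (Tx a).
Proof. by apply: fsmodP => p; exact: tele_twist. Qed.

Let eval_total b : ev x (total b) = fsext (fun _ : X => ev x) b.
Proof. by rewrite /total linear_fsext; exact: eq_fsext. Qed.

Let eval_tw b : eval_sum (tw b) = ev x (total b).
Proof.
rewrite eval_total /eval_sum fsext_fsmap; apply: eq_fsext => p _ /=.
by rewrite eval_twist ?prime_rep_neq0.
Qed.

Let eval_Txp e : eval_sum (Txp e) = 0.
Proof.
rewrite /eval_sum fsext_fsmap /fsext fsbig1// => p _ /=.
by apply/(teleP (xp0 p)); exists (entry p e).
Qed.

(** [total] and [tw] lift to telescopes the sum map and the coordinatewise inclusions on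
    [R[1/x]^(X)]; with opposite signs these give the kernel of partial fractions, by
    [partial_fraction_unique]. The rest is a chase through exact telescopes. *)
Lemma factorial_dim2_pd : pd_le Q 2.
Proof.
have Lp : lifts_on (@setT L) by exact: lifts_on_poly.
have FXp : lifts_on (@setT FX) by exact: lifts_on_fsmod.
apply: (@pd_le_of_resolution R Q (L * FX)%type (FX * (L * FX))%type FX
  eps (mklinear cone1_linear) (mklinear cone2_linear)).
- exact/lifts_on_projectiveT/lifts_on_prod.
- by apply/lifts_on_projectiveT/lifts_on_prod => //; exact: lifts_on_prod.
- exact: lifts_on_projectiveT.
- exact: eps_surj.
- move=> [c e]; split=> [ce0|[[b [c' e']] <-]] /=; last first.
    rewrite /eps /cone1 /= linearD /= [eval_sum _]linearB /= -!/(eval_sum _).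
    rewrite eval_Txp eval_tw sub0r addrAC subrr add0r.
    by apply/(teleP x0); exists c'.
  (* The first alternative lets [b] vanish off the support of [e], as finiteness requires; the
     second then holds everywhere. *)
  have [b bE] : exists b : FX, forall p, entry p b = 0 /\ entry p e = 0 \/
      ev x (entry p b) = - ev (x * val p) (entry p e) :> Q.
    apply: (fsmod_choice (P := fun p v => v = 0 /\ entry p e = 0 \/
      ev x v = - ev (x * val p) (entry p e) :> Q) (finite_supp e)) => p.
      by move=> pe; left; split=> //; exact: entry_eq0.
    have [v vE] := partial_fraction_unique p ce0; exists (- v).
    by right; rewrite linearN vE.
  have {}bE p : ev x (entry p b) = - ev (x * val p) (entry p e) :> Q.
    by case: (bE p) => // -[-> ->]; rewrite !linear0.
  (* Each coordinate of [e + tw b] evaluates to 0, so it comes from its telescope. *)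
  have [e' eE] : exists e' : FX, forall p,
      T (x * val p) (entry p e') = entry p (e + tw b).
    apply: (fsmod_choice (P := fun p v => T (x * val p) v = entry p (e + tw b))
      (finite_supp (e + tw b))) => p.
      by move=> pe; rewrite (entry_eq0 pe) linear0.
    apply/(teleP (xp0 p)).
    have -> : entry p (e + tw b) = entry p e + twist (val p) (entry p b) by [].
    by rewrite linearD /= eval_twist ?prime_rep_neq0// bE subrr.
  have {}eE : Txp e' = e + tw b by apply: fsmodP => p; exact: eE.
  have [c' cE] : exists c', T x c' = c - total b.
    apply/(teleP x0); rewrite linearB /= eval_total.
    have -> : fsext (fun _ : X => ev x) b = - eval_sum e.
      have := eval_Txp e'; rewrite eE /eval_sum linearD /= => /eqP.
      by rewrite addrC addr_eq0 -/(eval_sum _) eval_tw eval_total => /eqP.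
    by rewrite opprK.
  exists (b, (c', e')); rewrite /= /cone1 /= cE addrC subrK; congr (_, _).
  by rewrite eE addrK.
- move=> [b [c e]]; split=> [bce0|[a <-]] /=; last first.
    rewrite /cone1 /cone2 /= total_Tx Txp_tw linearN /= !subrr.
    by [].
  have bc : total b + T x c = 0 by have := congr1 fst bce0.
  have eb : Txp e - tw b = 0 by have := congr1 snd bce0.
  have {}eb : Txp e = tw b by apply/eqP; rewrite -subr_eq0; apply/eqP; exact: eb.
  have [a aE] : exists a : FX, forall p, T x (entry p a) = entry p b.
    apply: (fsmod_choice (P := fun p v => T x v = entry p b) (finite_supp b)) => p.
      by move=> pe; rewrite (entry_eq0 pe) linear0.
    apply/(teleP x0); rewrite -(eval_twist _ (prime_rep_neq0 p) x0).
    apply/(teleP (xp0 p)); exists (entry p e).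
    by have := congr1 (entry p) eb; rewrite !entry_fsmap.
  have {}aE : Tx a = b by apply: fsmodP => p; exact: aE.
  exists a; rewrite /cone2 aE; congr (_, (_, _)).
    apply/eqP; rewrite eq_sym -subr_eq0 opprK; apply/eqP/(tele0 x0).
    by rewrite linearD /= -total_Tx aE addrC.
  by apply: Txp_inj; rewrite Txp_tw aE.
- move=> a ca0; have a0 : Tx a = 0 by have := congr1 fst ca0.
  apply: fsmodP => p; rewrite linear0; apply: (tele0 x0).
  by have := congr1 (entry p) a0; rewrite entry_fsmap linear0.
- by right.
Qed.

End FactorialDim2.

(** * Orders with countable initial segments *)

Section WellOrder.

(** Unique minima of sets of one, two and three elements give the order axioms; a minimal
    non-accessible element is excluded in the same way. *)
Lemma well_order_spec (T : eqType) (r : rel T) : well_order r ->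
  let lt x y := r x y /\ x <> y in
  [/\ well_founded lt, forall x y z, lt x y -> lt y z -> lt x z &
      forall x y, [\/ lt x y, x = y | lt y x]].
Proof.
move=> wo lt.
have rxx x : r x x.
  have [|z [[zx /(_ x)]]] := wo (pred1 x); first by exists x; exact: eqxx.
  by move: zx; rewrite inE => /eqP ->; rewrite inE eqxx => /(_ isT).
have anti x y : r x y -> r y x -> x = y.
  move=> xy yx; have [|z [_ zU]] := wo (pred2 x y); first by exists x; rewrite inE /= eqxx.
  have xE : minimum_of r (pred2 x y) x.
    by split=> [|u]; rewrite inE /= ?eqxx// => /orP[/eqP->|/eqP->].
  have yE : minimum_of r (pred2 x y) y.
    by split=> [|u]; rewrite inE /= ?eqxx ?orbT// => /orP[/eqP->|/eqP->].
  by rewrite -(zU x xE) -(zU y yE).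
have tot x y : r x y \/ r y x.
  have [|z [[zxy zm] _]] := wo (pred2 x y); first by exists x; rewrite inE /= eqxx.
  have zx : r z x by apply: zm; rewrite inE /= eqxx.
  have zy : r z y by apply: zm; rewrite inE /= eqxx orbT.
  by move: zxy; rewrite inE => /orP[/eqP<-|/eqP<-]; [left|right].
have trans x y z : r x y -> r y z -> r x z.
  move=> xy yz; have [//|zx] := tot x z.
  have [w [[wxyz wm] _]] : exists! w, minimum_of r (pred3 x y z) w.
    by apply: wo; exists x; rewrite inE /= eqxx.
  have wx : r w x by apply: wm; rewrite inE /= eqxx.
  have wy : r w y by apply: wm; rewrite inE /= eqxx orbT.
  have wz : r w z by apply: wm; rewrite inE /= eqxx !orbT.
  move: wxyz; rewrite inE => /or3P[]/eqP wE; rewrite wE in wx wy wz => //.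
    by rewrite (anti x y).
  by rewrite -(anti y z).
split.
- move=> x; apply: contrapT => nx.
  have [|z [[nz zm] _]] := wo [pred x | ~~ `[< Acc lt x >]].
    by exists x; rewrite inE; apply/asboolPn.
  move: nz; rewrite inE => /asboolPn; apply; constructor=> y [yz ny].
  apply: contrapT => nAy; apply: ny; apply: anti => //; apply: zm.
  by rewrite inE; apply/asboolPn.
- move=> x y z [xy nxy] [yz nyz]; split; first exact: trans yz.
  by move=> xz; apply: nyz; apply: anti => //; rewrite -xz.
- move=> x y; have [->|/eqP nxy] := eqVneq x y; first by constructor 2.
  have [xy|yx] := tot x y; first by constructor 1.
  by constructor 3; split=> //; exact/nesym.
Qed.

Local Open Scope card_scope.

(** If some initial segment of a well-order of [T] is uncountable, take the least [a] with such a
    segment. The continuum hypothesis embeds [set nat], hence [T], into the segment below [a], and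
    the order is pulled back along this embedding. *)
Lemma ex_aleph1_order (T : choiceType) : continuum_hypothesis ->
  (exists f : T -> set nat, injective f) ->
  exists lt : T -> T -> Prop,
    [/\ well_founded lt, forall x y z, lt x y -> lt y z -> lt x z,
        forall x y, [\/ lt x y, x = y | lt y x] & forall a, countable [set b | lt b a]].
Proof.
move=> [_ CH] [f finj]; have [r /well_order_spec] := well_ordering_principle T.
set lt := fun x y : T => _ => -[wf trans tot].
have [allc|] := pselect (forall a, countable [set b | lt b a]); first by exists lt.
move=> /existsNP[a0 na0].
have [a [na amin]] : exists a, ~ countable [set b | lt b a] /\
    forall b, lt b a -> countable [set c | lt c b].
  elim/(well_founded_ind wf): a0 na0 => a IH na.
  have [allb|] := pselect (forall b, lt b a -> countable [set c | lt c b]); first by exists a.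
  by move=> /existsNP[b /not_implyP[ba nb]]; exact: IH nb.
have [g gB ginj] : exists2 g : T -> T, forall x, lt (g x) a & injective g.
  have /card_leP[h] := CH _ _ na.
  pose k x : set_type [set: set nat] := SigSub (mem_set (I : [set: set nat] (f x))).
  exists (fun x => val (h (k x))) => [x|x y /val_inj/(@inj _ _ _ h)].
    exact: set_mem (valP (h (k x))).
  by rewrite !inE => /(_ I I)/(congr1 val)/finj.
exists (fun x y => lt (g x) (g y)); split.
- move=> x; move e : (g x) => y; elim/(well_founded_ind wf): y x e => y IH x e.
  by constructor=> z; rewrite e => zy; exact: IH (g z) zy z erefl.
- by move=> x y z; exact: trans.
- move=> x y; have [xy|/ginj ->|yx] := tot (g x) (g y).
  + by constructor 1.
  + by constructor 2.
  + by constructor 3.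
- move=> b; have /countable_injP[h hinj] := amin _ (gB b).
  apply/countable_injP; exists (h \o g) => x y; rewrite !inE => xb yb /= hxy.
  by apply: ginj; apply: hinj; rewrite ?inE.
Qed.

End WellOrder.

(** * Cardinality of complete local rings *)

Section Cardinality.

(** The rationals below the real and imaginary parts determine a complex number. *)
Lemma complex_inj_nat (K : realType) : exists f : K[i] -> set nat, injective f.
Proof.
pose part (b : bool) (z : K[i]) : K := if b then complex.Re z else complex.Im z.
pose f z : set nat := [set n | exists (b : bool) (q : rat),
  n = choice.pickle (b, q) /\ ratr q < part b z].
exists f => z z' ff.
have lepart (u v : K[i]) b : f u = f v -> ~ (part b u < part b v).
  move=> fuv /rat_in_itvoo[q]; rewrite in_itv/= => /andP[uq qv].
  have : f v (choice.pickle (b, q)) by exists b, q.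
  rewrite -fuv => -[b' [q' [/(pcan_inj choice.pickleK) [<- <-] qu]]].
  by move: (lt_trans uq qu); rewrite ltxx.
have partE b : part b z = part b z'.
  apply/eqP; rewrite eq_le !leNgt.
  by apply/andP; split; apply/negP; exact: lepart.
by case: z z' {ff lepart} partE => [x y] [x' y'] e; congr complex.Complex;
  [exact: (e true)|exact: (e false)].
Qed.

(** Codes with [oj = None] record that position [k] of list [n] is occupied, and its label [l];
    codes with [Some j] record the elements of [g x]. The former are needed because [g x] may be
    empty. *)
Lemma seq_fun_inj_nat (T : Type) : (exists f : T -> set nat, injective f) ->
  exists f : (nat -> seq (T * nat)) -> set nat, injective f.
Proof.
move=> [g ginj].
pose f (c : nat -> seq (T * nat)) : set nat := [set N | exists n k l oj x,
  [/\ N = choice.pickle (n, k, l, oj : option nat), onth (c n) k = Some (x, l) &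
      if oj is Some j then g x j else True]].
have fP c n k l oj : f c (choice.pickle (n, k, l, oj : option nat)) ->
    exists x, onth (c n) k = Some (x, l) /\ if oj is Some j then g x j else True.
  by case=> n' [k' [l' [oj' [x [/(pcan_inj choice.pickleK)[<- <- <- <-]]]]]]; exists x.
have onthP c c' n k z : f c = f c' -> onth (c n) k = Some z -> onth (c' n) k = Some z.
  case: z => x l cc' e.
  have : f c (choice.pickle (n, k, l, None : option nat)) by exists n, k, l, None, x.
  rewrite cc' => /fP[y [yE _]]; rewrite yE; congr (Some (_, _)); apply: ginj.
  apply/seteqP; split=> j gj.
    have : f c' (choice.pickle (n, k, l, Some j)) by exists n, k, l, (Some j), y.
    by rewrite -cc' => /fP[z [zE]]; move: zE; rewrite e => -[->].
  have : f c (choice.pickle (n, k, l, Some j)) by exists n, k, l, (Some j), x.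
  by rewrite cc' => /fP[z [zE]]; move: zE; rewrite yE => -[->].
exists f => c c' cc'; apply: funext => n; apply: eq_from_onth => k.
case e : (onth (c n) k) => [z|]; first by rewrite (onthP _ _ _ _ _ cc' e).
case e' : (onth (c' n) k) => [z|//].
by rewrite (onthP _ _ _ _ _ (esym cc') e') in e.
Qed.

End Cardinality.

Section CompleteLocalCardinality.
Variables (R : idomainType) (m : set R).
Hypotheses (noeth : noetherian R) (mloc : is_local m) (complete : adic_complete m).

Lemma ideal_powS n a b : m a -> ideal_pow m n b -> ideal_pow m n.+1 (a * b).
Proof.
move=> ma; have hI := ideal_pow_ideal m n.+1.
suff : ideal_span [set x | exists f : 'I_n -> R, (forall i, m (f i)) /\
    x = \prod_(i < n) f i] `<=` [set b | ideal_pow m n.+1 (a * b)] by apply.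
apply: ideal_span_min.
  split=> [|x y xm ym|c x xm] /=.
  - by rewrite mulr0; exact: is_ideal0.
  - by rewrite mulrDr; exact: is_idealD.
  - by rewrite mulrCA; exact: is_idealM.
move=> _ [f [fm ->]] /=; apply: ideal_span_sub.
exists (fun i => oapp f a (unlift ord0 i)); split.
  by move=> i; case: unlift.
by rewrite big_ord_recl unlift_none /=; congr (_ * _); apply: eq_bigr => i _; rewrite liftK.
Qed.

Lemma ideal_pow0 x : ideal_pow m 0 x.
Proof.
rewrite -[x]mulr1; apply: (is_idealM _ (ideal_pow_ideal m 0)); apply: ideal_span_sub.
have f : 'I_0 -> R by case.
by exists f; rewrite big_ord0; split=> // -[].
Qed.

(** The constant sequence [y] converges both to [y] and to 0. *)
Lemma adic_separated y : (forall n, ideal_pow m n y) -> y = 0.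
Proof.
move=> ym; have [|l [_ lU]] := complete (u := fun=> y).
  by move=> n; exists 0%N => i j _ _; rewrite subrr; exact: is_ideal0 (ideal_pow_ideal m n).
rewrite -(lU y); last by move=> n; exists 0%N => i _; rewrite subrr; exact: is_ideal0 (ideal_pow_ideal m n).
by apply: lU => n; exists 0%N => i _; rewrite subr0.
Qed.

(** A digit expansion: modulo the next power of [m], an element of [ideal_pow m n] is a combination
    of finitely many generators with coefficients among chosen residue representatives. By
    separatedness the digits determine the element. *)
Lemma complete_local_inj (T : Type) (rho : R -> T) :
  (forall x y, rho x = rho y -> m (x - y)) ->
  exists f : R -> (nat -> seq (T * nat)), injective f.
Proof.
move=> rhom; pose sigma c := xget 0 [set z | rho z = c].
have sigmaP x : m (x - sigma (rho x)).
  by apply: rhom; rewrite [RHS](@xgetPex _ 0 [set z | rho z = rho x])//; exists x.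
have /choice[h hE] : forall n, exists s : seq R, ideal_pow m n = ideal_span [set` s].
  by move=> n; apply: noeth; exact: ideal_pow_ideal.
pose value n (l : seq (T * nat)) : R := \sum_(p <- l) sigma p.1 * (h n)`_p.2.
have /choice[l lP] : forall ny : nat * R, exists l, ideal_pow m ny.1 ny.2 ->
    ideal_pow m ny.1.+1 (ny.2 - value ny.1 l).
  case=> n y /=; have [yn|] := pselect (ideal_pow m n y); last by exists [::].
  have : ideal_span [set` h n] y by rewrite -hE.
  case=> s [sh yE]; exists [seq (rho p.1, index p.2 (h n)) | p <- s] => _.
  rewrite /value big_map yE -sumrB; apply: is_ideal_sum; first exact: ideal_pow_ideal.
  move=> p /sh /= ph; rewrite nth_index// -mulrBl; apply: ideal_powS => //.
  by rewrite hE; exact: ideal_span_sub.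
(* The remainder of [y] after [n] digits; equal digits leave differences of remainders unchanged. *)
pose rem y n := nat_rect (fun=> R) y (fun n r => r - value n (l (n, r))) n.
have remP y n : ideal_pow m n (rem y n).
  by elim: n => [|n IH]; [exact: ideal_pow0|exact: (lP (n, rem y n))].
exists (fun y n => l (n, rem y n)) => y z yz.
have remB n : y - z = rem y n - rem z n.
  elim: n => [//|n IH]; rewrite /rem /= -/(rem y n) -/(rem z n).
  have /= -> := congr1 (fun f => f n) yz; by rewrite opprB addrA subrK.
apply/eqP; rewrite -subr_eq0; apply/eqP; apply: adic_separated => n.
by rewrite (remB n); apply: is_idealB => //; exact: ideal_pow_ideal.
Qed.

Lemma residue_complex_inj_nat (K : realType) : residue_field_iso mloc K[i] ->
  exists f : R -> set nat, injective f.
Proof.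
move=> [phi phi_bij].
pose rho (x : R) : K[i] := phi (\pi_(residue_ring mloc)%qT x).
have rhom x y : rho x = rho y -> m (x - y).
  move=> /(bij_inj phi_bij)/eqP; rewrite -Quotient.idealrBE.
  by rewrite unfold_in => /asboolP.
have [f finj] := complete_local_inj rhom.
have [g ginj] := seq_fun_inj_nat (complex_inj_nat K).
by exists (g \o f); exact: inj_comp.
Qed.

End CompleteLocalCardinality.

(** * Quotient fields of cardinality at most aleph one *)

Section Localization.
Variable R : idomainType.
Local Notation Q := (fraction_module R).
Local Notation "x %:F" := (tofrac x).

(** The localization of R at the multiplicative set generated by the nonzero elements of [C], inside
    Q. *)
Definition locQ (C : set R) : set Q := [set x | exists (s : seq R) (a : R),
  (forall r, r \in s -> C r /\ r != 0) /\ x = a *: invQ (\prod_(r <- s) r)].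

Lemma prod_neq0 (s : seq R) : (forall r, r \in s -> r != 0) -> \prod_(r <- s) r != 0.
Proof.
by move=> s0; rewrite prodf_seq_neq0; apply/allP => r /s0 ->; rewrite implybT.
Qed.

Lemma locQ_mono C C' : C `<=` C' -> locQ C `<=` locQ C'.
Proof.
by move=> CC' _ [s [a [sC ->]]]; exists s, a; split=> // r /sC[/CC' Cr r0].
Qed.

Lemma locQT x : locQ setT x.
Proof.
have [a [b [b0 ->]]] := fractionP x; exists [:: b], a; rewrite big_seq1; split=> //.
by move=> r; rewrite inE => /eqP ->.
Qed.

(** Enumerate the denominators as [g i] and let [t n] be the product of [g 0 ... g k] over [k < n].
    Each [g i] recurs in all later factors, so any finite product of denominators divides some
    [t n]. *)
Lemma locQ_countable C : countable C -> exists s t : nat -> R,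
  [/\ forall n, t n != 0, forall n, t n.+1 = s n * t n, forall n, locQ C (invQ (t n)) &
      forall x, locQ C x -> exists n a, x = a *: invQ (t n)].
Proof.
move=> /(countable_enum 0)[f Cf].
pose g i := if `[< C (f i) /\ f i != 0 >] then f i else 1.
have gP i : g i = 1 \/ C (g i) /\ g i != 0.
  by rewrite /g; case: asboolP; [right|left].
have g0 i : g i != 0 by case: (gP i) => [->|[]]; first exact: oner_neq0.
pose s n := \prod_(i < n.+1) g i; pose t n := \prod_(k < n) s k.
have s0 n : s n != 0 by apply/prodf_neq0 => i _; exact: g0.
have t0 n : t n != 0 by apply/prodf_neq0 => i _; exact: s0.
have tS n : t n.+1 = s n * t n by rewrite /t big_ord_recr mulrC.
pose D (y : R) := exists2 r : seq R, forall z, z \in r -> C z /\ z != 0 & y = \prod_(z <- r) z.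
have D1 : D 1 by exists [::]; rewrite ?big_nil.
have DM y z : D y -> D z -> D (y * z).
  move=> [r rC ->] [r' rC' ->]; exists (r ++ r'); last by rewrite big_cat.
  by move=> w; rewrite mem_cat => /orP[/rC|/rC'].
have Dg i : D (g i).
  have [->//|Cg] := gP i; exists [:: g i]; last by rewrite big_seq1.
  by move=> z; rewrite inE => /eqP ->.
exists s, t; split=> // [n|_ [r [a [rC ->]]]].
  have [r rC ->] : D (t n) by apply: big_ind => // k _; apply: big_ind => // i _.
  by exists r, 1; rewrite scale1r.
have tdvd n k : (n <= k)%N -> rdvd (t n) (t k).
  elim: k => [|k IH]; first by rewrite leqn0 => /eqP ->; exact: rdvd_refl.
  rewrite leq_eqVlt => /predU1P[->|/ltnSE/IH nk]; first exact: rdvd_refl.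
  by rewrite tS; exact: rdvd_mull.
have [n [c tE]] : exists n, rdvd (\prod_(z <- r) z) (t n).
  elim: r rC => [|z r IH] rC; first by exists 0%N, 1; rewrite /t big_ord0 big_nil mulr1.
  have [|n [c tE]] := IH; first by move=> w wr; apply: rC; rewrite inE wr orbT.
  have [Cz z0] := rC z (mem_head _ _); have [j _ fj] := Cf z Cz.
  have gj : g j = z by rewrite /g fj; case: asboolP => // -[].
  exists (maxn n j).+1; rewrite big_cons tS.
  have [d dE] := tdvd n (maxn n j) (leq_maxl _ _).
  have jn : (j < (maxn n j).+1)%N by rewrite ltnS leq_maxr.
  rewrite /s (bigD1 (Ordinal jn))//= gj dE tE.
  set P := \prod_(i < _ | _) _; exists (P * d * c); ring.
exists n, (a * c); have r0 : \prod_(z <- r) z != 0 by apply: prod_neq0 => z /rC[].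
have c0 : c != 0 by move: (t0 n); rewrite tE mulf_eq0 negb_or => /andP[].
by rewrite tE -scalerA scale_invQM.
Qed.

End Localization.

(** * Functorial syzygies and the filtration argument *)

Section Syzygies.
Variable R : idomainType.
Local Notation Q := (fraction_module R).
Local Notation L := ({poly R} : lmodType R).
Local Notation F0 := (freemod R Q).
Local Notation F1 := (freemod R F0).

(** The relations of the free cover of [A] by the free module on [A] itself. Being functorial in
    [A], it turns chains of submodules of Q into chains inside one fixed free module. *)
Definition syz0 (A : set Q) : set F0 := [set w | supp w `<=` A /\ lincomb Q w = 0].

Definition syz1 (A : set Q) : set F1 := [set w | supp w `<=` syz0 A /\ lincomb F0 w = 0].

Lemma submoduleI (V : lmodType R) (S S' : set V) :
  submodule S -> submodule S' -> submodule (S `&` S').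
Proof.
move=> hS hS'; split; first by split; exact: submodule0.
by move=> a x y [Sx Sx'] [Sy Sy']; split; [exact: hS.2|exact: hS'.2].
Qed.

Lemma syz0_submodule A : submodule (syz0 A).
Proof. exact: (submoduleI (submodule_supp _ A) (submodule_ker (lincomb Q))). Qed.

Lemma syz1_submodule A : submodule (syz1 A).
Proof. exact: (submoduleI (submodule_supp _ (syz0 A)) (submodule_ker (lincomb F0))). Qed.

Lemma syz0_mono A B : A `<=` B -> syz0 A `<=` syz0 B.
Proof. by move=> AB w [wA w0]; split=> //; exact: subset_trans AB. Qed.

Lemma syz1_mono A B : A `<=` B -> syz1 A `<=` syz1 B.
Proof. by move=> /syz0_mono AB w [wA w0]; split=> //; exact: subset_trans AB. Qed.

(* Schanuel's lemma, comparing the free cover [F0] of [A] with the telescope. *)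
Lemma lifts_on_syz0 (s t : nat -> R) (A : set Q) :
  (forall n, t n != 0) -> (forall n, t n.+1 = s n * t n) ->
  (forall n, A (invQ (t n))) -> (forall x, A x -> exists n a, x = a *: invQ (t n)) ->
  lifts_on (syz0 A).
Proof.
move=> t0 tS At tA M N g W f hW fl gf.
pose u := tele_eval t.
pose phi : {linear F0 -> L} := extend (fun q : Q => xget 0 [set p : L | u p = q]).
pose psi : {linear L -> F0} := polyext (fun n => gen R (invQ (t n) : Q)).
have uphi w : supp w `<=` A -> u (phi w) = lincomb Q w.
  move=> wA; rewrite [LHS]linear_fsext; apply: eq_fsext => q /wA Aq.
  rewrite /= linearZ /=; congr (_ *: _).
  have [n [a qE]] : exists n a, q = a *: invQ (t n) by exact: tA.
  apply: (@xgetPex _ 0 [set p : L | u p = q]); exists (a *: 'X^n) => /=.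
  by rewrite linearZ /= tele_evalX -qE.
have freepsi p : lincomb Q (psi p) = u p.
  rewrite [RHS]linear_polyE [LHS](linear_polyE (lincomb Q \o psi)).
  apply: eq_bigr => n _; congr (_ *: _) => /=.
  by rewrite polyextX tele_evalX /lincomb extend_gen.
have psiA p : supp (psi p) `<=` A.
  apply: (polyext_in (S := [set w : F0 | supp w `<=` A])) => [|n].
    exact: submodule_supp.
  by move=> q /supp_gen ->; exact: At.
(* On [syz0 A], [w = r w + psi (phi w)]: the first part factors through the free module [F0], the
   second through the projective kernel of the telescope. *)
pose r w := restr A w - psi (phi (restr A w)).
have rl a v w : r (a *: v + w) = a *: r v + r w.
  by rewrite /r !linearP /= scalerBr scalerN addrACA.
have rS w : syz0 A (r w).
  split; last by rewrite linearB /= freepsi uphi ?subrr//; exact: supp_restr.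
  apply: (submoduleB (submodule_supp _ A)); first exact: supp_restr.
  exact: psiA.
have psiS p : u p = 0 -> syz0 A (psi p) by move=> up; split; rewrite ?freepsi.
have [||h1 [h1l h1P]] := @lifts_on_free R Q M N g W (f \o r) hW.
- by move=> a v w _ _; rewrite /= rl fl.
- by move=> w _; exact: gf.
have [||h2 [h2l h2P]] := lifts_on_tele_ker t0 tS (f := f \o psi) hW (g := g).
- by move=> a p q /= up uq; rewrite linearP fl//; exact: psiS.
- by move=> p up; apply/gf/psiS.
have phiS w : syz0 A w -> u (phi w) = 0 by move=> [wA w0]; rewrite uphi.
exists (fun w => h1 w + h2 (phi w)); split=> [a v w Sv Sw|w Sw].
  rewrite h1l// linearP h2l; [|exact: phiS|exact: phiS].
  by rewrite scalerDr addrACA.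
have [Wh1 gh1] := h1P w I; have [Wh2 gh2] := h2P (phi w) (phiS w Sw).
split; first exact: (submoduleD hW).
rewrite linearD gh1 gh2 /= -(linear_onD fl)//; last exact/psiS/phiS.
by rewrite /r restr_id ?subrK//; case: Sw.
Qed.

(** A section of the free cover of the projective module [syz0 A] yields a projection onto the
    kernel of that cover; [restr] extends it to all of [F1]. *)
Lemma syz1_retract A : lifts_on (syz0 A) ->
  exists r : {linear F1 -> F1}, (forall w, syz1 A (r w)) /\ forall w, syz1 A w -> r w = w.
Proof.
move=> lA.
have [||sigma [sl sP]] := lA F1 F0 (lincomb F0) [set w | supp w `<=` syz0 A] id (submodule_supp _ _).
- by [].
- move=> x Sx; exists (gen R x); last exact: extend_gen.
  by move=> y /supp_gen ->.
pose r w := restr (syz0 A) w - sigma (lincomb F0 (restr (syz0 A) w)).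
have Sr w : syz0 A (lincomb F0 (restr (syz0 A) w)).
  by apply: lincomb_in; [exact: syz0_submodule|exact: supp_restr].
have rl : linear r.
  move=> a v w; rewrite /r !linearP sl; try exact: Sr.
  by rewrite /= opprD addrACA -scalerBr.
exists (mklinear rl); split=> w /=.
  have [sw fw] := sP _ (Sr w); split; last by rewrite /r linearB /= fw subrr.
  by apply: (submoduleB (submodule_supp _ _)) => //; exact: supp_restr.
move=> [wS w0]; rewrite /r restr_id// w0.
by rewrite (linear_on0 (syz0_submodule A) sl) subr0.
Qed.

Section Directed.
Variables (T : Type) (D : set T).
Hypothesis D0 : D !=set0.

Lemma directed_finite (U : choiceType) (Y : T -> set U) (F : set U) :
  (forall a b, D a -> D b -> Y a `<=` Y b \/ Y b `<=` Y a) ->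
  finite_set F -> F `<=` \bigcup_(b in D) Y b -> exists2 b, D b & F `<=` Y b.
Proof.
move=> Ytot /finite_seqP[s ->] {F}; elim: s => [|x s IH] sY.
  by have [b Db] := D0; exists b.
have [|b Db sb] := IH; first by move=> y ys; apply: sY; rewrite /= inE ys orbT.
have [c Dc xc] := sY x (mem_head _ _).
have [bc|cb] := Ytot b c Db Dc.
  by exists c => // y; rewrite /= inE => /predU1P[->//|/sb/bc].
by exists b => // y; rewrite /= inE => /predU1P[->|/sb//]; exact: cb.
Qed.

Lemma locQ_directed (C : T -> set R) :
  (forall a b, D a -> D b -> C a `<=` C b \/ C b `<=` C a) ->
  locQ (\bigcup_(b in D) C b) `<=` \bigcup_(b in D) locQ (C b).
Proof.
move=> Ctot _ [s [a [sC ->]]].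
have [||b Db sb] := @directed_finite _ C [set` s] Ctot.
- exact: finite_seq.
- by move=> r /= /sC[].
by exists b => //; exists s, a; split=> // r rs; split; [exact: sb|case: (sC r rs)].
Qed.

(** Syzygies commute with unions of nonempty chains because supports are finite, at both levels. *)
Lemma syz1_directed (A : T -> set Q) :
  (forall a b, D a -> D b -> A a `<=` A b \/ A b `<=` A a) ->
  syz1 (\bigcup_(b in D) A b) `<=` \bigcup_(b in D) syz1 (A b).
Proof.
move=> Atot w [wA w0].
have Stot a b : D a -> D b -> syz0 (A a) `<=` syz0 (A b) \/ syz0 (A b) `<=` syz0 (A a).
  by move=> Da Db; have [ab|ba] := Atot a b Da Db; [left|right]; exact: syz0_mono.
have [||b Db sb] := @directed_finite _ (fun b => syz0 (A b)) (supp w) Stot.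
- exact: finite_supp.
- move=> v /wA[vA v0].
  have [||b Db sb] := @directed_finite _ A (supp v) Atot => //.
    exact: finite_supp.
  by exists b.
by exists b.
Qed.

End Directed.

Section Aleph1.
Variable lt : R -> R -> Prop.
Hypothesis lt_wf : well_founded lt.
Hypothesis lt_trans : forall x y z, lt x y -> lt y z -> lt x z.
Hypothesis lt_total : forall x y, [\/ lt x y, x = y | lt y x].
Hypothesis lt_countable : forall a, countable [set b | lt b a].

(** [sege a] generates the layer at [a], and [seg a] the union of the earlier layers, onto which
    [rho a] will project. *)
Let seg a : set R := [set b | lt b a].
Let sege a : set R := [set b | lt b a \/ b = a].

Let sege_mono a b : lt a b \/ a = b -> sege a `<=` sege b.
Proof.
move=> ab c; case: ab => [ab|->//] [ca|->]; last by left.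
by left; exact: lt_trans ca ab.
Qed.

Let sege_chain a b : sege a `<=` sege b \/ sege b `<=` sege a.
Proof.
have [ab|ab|ba] := lt_total a b.
- by left; apply: sege_mono; left.
- by left; apply: sege_mono; right.
- by right; apply: sege_mono; left.
Qed.

Let syz1_countable_retract C : countable C -> exists r : {linear F1 -> F1},
  (forall w, syz1 (locQ C) (r w)) /\ forall w, syz1 (locQ C) w -> r w = w.
Proof.
move=> /locQ_countable[s [t [t0 tS Ct tC]]]; apply: syz1_retract.
exact: lifts_on_syz0 t0 tS Ct tC.
Qed.

(** The localizations at [seg a] and [sege a] are countable telescopes, so their second syzygies are
    retracts of [F1]. This provides both the projectivity of the layers and the projections for the
    filtration lemma. *)
Lemma lifts_on_syz1 : lifts_on (syz1 setT).
Proof.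
have sege_countable a : countable (sege a).
  have -> : sege a = seg a `|` [set a] by [].
  by apply: countableU; [exact: lt_countable|exact: countable1].
pose S a := syz1 (locQ (sege a)).
have -> : syz1 setT = \bigcup_a S a.
  apply/seteqP; split=> [w wT|w [a _]]; last exact: syz1_mono.
  apply: (@syz1_directed R setT) => //.
  - by exists 0.
  - by move=> a b _ _; have [ab|ba] := sege_chain a b; [left|right]; exact: locQ_mono.
  apply: syz1_mono wT => x _.
  apply: (@locQ_directed R setT); first by exists 0.
    by move=> a b _ _; exact: sege_chain.
  by apply: locQ_mono (locQT x) => a _; exists a => //; right.
(* At the least element there is no earlier layer to land in, so [rho] is 0 there. *)
have /choice[rho rhoP] : forall a, exists r : {linear F1 -> F1},
    (seg a = set0 -> forall w, r w = 0) /\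
    (seg a !=set0 -> (forall w, syz1 (locQ (seg a)) (r w)) /\
       forall w, syz1 (locQ (seg a)) w -> r w = w).
  move=> a; have [s0|/set0P s0] := eqVneq (seg a) set0.
    by exists \0; split=> // -[b]; rewrite s0.
  have [r rP] := syz1_countable_retract (lt_countable a).
  by exists r; split=> // sa; case: s0 => b; rewrite sa.
apply: (@lifts_on_filtration R F1 R 0 lt S (fun a w => rho a w)) => //.
- by move=> a; exact: syz1_submodule.
- by move=> a b ab; apply/syz1_mono/locQ_mono/sege_mono; left.
- move=> a; have [r [rS rK]] := syz1_countable_retract (sege_countable a).
  exact: lifts_on_retract (@lifts_on_free R F0) rS rK.
- by move=> a; exact: linear_linear_on.
- move=> a b v ba Sv; have [_ [|_ rK]] := rhoP a; first by exists b.
  apply: rK; apply: syz1_mono Sv; apply: locQ_mono => c [cb|->//].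
  exact: lt_trans cb ba.
- move=> a v Sv; have [s0|/set0P s0] := eqVneq (seg a) set0.
    by left; exact: (rhoP a).1.
  right; have [_ /(_ s0)[rS _]] := rhoP a.
  apply: (@syz1_directed R (seg a) s0 (fun b => locQ (sege b))).
    by move=> b c _ _; have [bc|cb] := sege_chain b c; [left|right]; exact: locQ_mono.
  apply: syz1_mono (rS v) => x xa.
  apply: (@locQ_directed R (seg a) s0 sege); first by move=> b c _ _; exact: sege_chain.
  by apply: locQ_mono xa => b ba; exists b => //; right.
Qed.

Lemma aleph1_pd : pd_le Q 2.
Proof.
have h1 : submodule [set w : F1 | supp w `<=` syz0 setT] by exact: submodule_supp.
have h2 := syz1_submodule setT.
pose d0 (w : submod h1) : F0 := lincomb F0 (submod_val w).
have d0l : linear d0 by move=> a v w; rewrite /d0 !linearP.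
have sub21 (w : submod h2) : supp (submod_val w) `<=` syz0 setT.
  by have [] := submodP w.
pose d1 (w : submod h2) : submod h1 := mksubmod h1 (sub21 w).
have d1l : linear d1 by move=> a v w; apply: submod_inj.
(* The middle term is free on [syz0 setT], realized inside [F1] as the image of [restr]. *)
apply: (@pd_le_of_resolution R Q F0 (submod h1) (submod h2)
  (lincomb Q) (mklinear d0l) (mklinear d1l)).
- exact/lifts_on_projectiveT/lifts_on_free.
- apply: lifts_on_projective; apply: (@lifts_on_retract _ _ _ (restr (syz0 setT))).
  + exact: lifts_on_free.
  + by move=> w; exact: supp_restr.
  + by move=> w; exact: restr_id.
- exact/lifts_on_projective/lifts_on_syz1.
- by move=> q; exists (gen R q); exact: extend_gen.
- move=> x; split=> [x0|[w <-]] /=.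
    have gS : supp (gen R x) `<=` syz0 setT by move=> y /supp_gen ->; split.
    by exists (mksubmod h1 gS); exact: extend_gen.
  have : syz0 setT (d0 w) by apply: lincomb_in; [exact: syz0_submodule|exact: (submodP w)].
  by case.
- move=> w; split=> [w0|[v <-]] /=; last by case: (submodP v).
  have Sw : syz1 setT (submod_val w) by split=> //; exact: (submodP w).
  by exists (mksubmod h2 Sw); apply: submod_inj.
- by move=> w w0; apply: submod_inj; have := congr1 (@submod_val _ _ _ _) w0.
- by right.
Qed.

End Aleph1.
End Syzygies.

(** * Projective dimension of the quotient field *)

Lemma krull_dim_gt0_nonzero (R : idomainType) (m : set R) (d : nat) :
  is_local m -> krull_dim R d -> (0 < d)%N -> exists2 s, m s & s != 0.
Proof.
move=> mloc [[p [pprime pincr]] _] d0.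
have [_ /existsNP[s /not_implyP[p1s p0s]]] := pincr 0%N d0.
exists s; first exact: (prime_sub_local mloc (pprime 1%N d0)).
apply/eqP => s0; apply: p0s; rewrite s0.
by have [[[]]] := pprime 0%N isT.
Qed.

Lemma factorial_pd_gt1 (R : idomainType) (m : set R) (d n : nat) :
  noetherian R -> is_local m -> adic_complete m -> krull_dim R d -> is_UFD R ->
  (1 < d)%N -> pd_le (fraction_module R) n -> (1 < n)%N.
Proof.
move=> noeth mloc complete dimR ufd d1 pdn; rewrite ltnNge; apply/negP => n1.
have [s ms s0] := krull_dim_gt0_nonzero mloc dimR (ltnW d1).
have [n0|n0] := posnP n.
  by apply: (fraction_pd_gt0 s0 ((local_nonunitP mloc s).2 ms)); rewrite -n0.
have nE : n = 1%N by apply/eqP; rewrite eqn_leq n1.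
rewrite nE in pdn.
have [D [D0 Ddvd]] := fraction_pd1_countable noeth mloc ms s0 pdn.
exact: (uncountable_denominators noeth mloc complete dimR d1 ufd D0 Ddvd).
Qed.

Theorem theorem11p3 (K : realType) (R : idomainType) (m : set R) (d : nat)
    (Rnoeth : noetherian R) (Rloc : is_local m) (Rcomplete : adic_complete m)
    (Rdim : krull_dim R d) :
  [/\ (* (a) *)
      d = 1%N -> pd_eq (fraction_module R) 1,
      (* (b) *)
      d = 2%N -> is_UFD R -> pd_eq (fraction_module R) 2,
      (* (c) *)
      continuum_hypothesis -> residue_field_iso Rloc K[i] ->
        pd_le (fraction_module R) 2 &
      (* (d) *)
      continuum_hypothesis -> residue_field_iso Rloc K[i] ->
        is_UFD R -> (1 < d)%N -> pd_eq (fraction_module R) 2].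
Proof.
have pd2 : continuum_hypothesis -> residue_field_iso Rloc K[i] ->
    pd_le (fraction_module R) 2.
  move=> CH /(residue_complex_inj_nat Rnoeth Rcomplete)/(ex_aleph1_order CH).
  by move=> [lt [wf trans total count]]; exact: aleph1_pd wf trans total count.
split=> [dE|dE ufd|//|CH res ufd d1].
- have [|s ms s0] := krull_dim_gt0_nonzero Rloc Rdim; first by rewrite dE.
  rewrite dE in Rdim; split; first exact: dim1_pd Rloc Rdim ms s0.
  case=> [pd0|//]; exfalso.
  exact: (fraction_pd_gt0 s0 ((local_nonunitP Rloc s).2 ms) pd0).
- have [|s ms s0] := krull_dim_gt0_nonzero Rloc Rdim; first by rewrite dE.
  split; first by rewrite dE in Rdim; exact: factorial_dim2_pd Rloc Rdim ufd ms s0.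
  move=> n pdn; apply: (factorial_pd_gt1 Rnoeth Rloc Rcomplete Rdim ufd _ pdn).
  by rewrite dE.
- split; first exact: pd2.
  by move=> n; exact: factorial_pd_gt1 Rnoeth Rloc Rcomplete Rdim ufd d1.
Qed.
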